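(* Let $R_n$ be the rook monoid, let $\mathcal{Y}_n$ be Halverson's complete set of inequivalent irreducible matrix representations of $R_n$ (indexed by partitions of $0,1,\dots,n$; see context), and let $\mathcal{T}^{s}_{\mathcal{Y}_n}(R_n)$ be the minimal number of operations needed to compute $\hat f(\rho)=\sum_{s\in R_n}f(s)\rho(s)$ for all $\rho\in\mathcal{Y}_n$, for an arbitrary element $f=\sum_{s\in R_n}f(s)s\in\mathbb{C}R_n$. Then for $n\ge 5$, $$\mathcal{T}^{s}_{\mathcal{Y}_n}(R_n)\le 2^n\,n\,|R_n|.$$
   Context: The rook monoid $R_n$ is the monoid of all partial injective maps of $\{1,\dots,n\}$ under composition of partial functions; maps act on the left. $\mathbb{C}R_n$ is its semigroup algebra. The set $\mathcal{Y}_n$. Let $\Lambda_n$ be the set of all partitions of all integers $k$ with $0\le k\le n$, identified with Young diagrams. For $\lambda\in\Lambda_n$, an $n$-standard tableau of shape $\lambda$ is a filling of the diagram of $\lambda$ with distinct numbers from $\{1,\dots,n\}$, increasing from left to right in rows and from top to bottom in columns (not all of $1,\dots,n$ need appear). Let $T_n^\lambda$ be the set of these, and let $V^\lambda$ be the $\mathbb{C}$-vector space with basis $\{v_L: L\in T_n^\lambda\}$. The content of the box in row $i$, column $j$ is $ct=j-i$, and $L(i)$ denotes the box of $L$ containing $i$. Let $t_i=(i-1,i)$ for $2\le i\le n$, let $t_iL$ be obtained from $L$ by exchanging the symbols $i-1$ and $i$ wherever they occur, and let $[n]\in R_n$ be the identity map restricted to $\{1,\dots,n-1\}$. The action of $R_n$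 on $V^\lambda$ is determined by its generators $t_2,\dots,t_n,[n]$: - if $i-1,i\in L$, then $t_iv_L=\frac{1}{ct(L(i))-ct(L(i-1))}v_L+\Big(1+\frac{1}{ct(L(i))-ct(L(i-1))}\Big)v_{L'}$, where $v_{L'}=v_{t_iL}$ if $t_iL$ is $n$-standard and $v_{L'}=0$ otherwise; - if exactly one of $i-1,i$ is in $L$, then $t_iv_L=v_{t_iL}$; - if neither is in $L$, then $t_iv_L=v_L$; - $[n]v_L=v_L$ if $n\notin L$, and $[n]v_L=0$ if $n\in L$. The $V^\lambda$, $\lambda\in\Lambda_n$, form a complete set of pairwise non-isomorphic irreducible $\mathbb{C}R_n$-modules (Halverson). $\mathcal{Y}_n$ is the set of corresponding matrix representations with respect to the bases $\{v_L\}$, ordered as follows (generalized last-letter order): for $L\ne L'$, let $m$ be the largest number which does not occupy the same position in $L$ and $L'$ (''absent'' counting as a position); the tableau in which $m$ is absent comes first, and if $m$ is present in both, the one in which $m$ lies in the higher row comes first. With this ordering, $\mathcal{Y}_n,\mathcal{Y}_{n-1},\dots,\mathcal Y_1$ are adapted to the chain $R_n>R_{n-1}>\dots>R_1$, where $R_k$ is identified with $\{\sigma\in R_n:\sigma(j)=j \text{ for } j>k\}$: the restriction of each element of $\mathcal{Y}_k$ to $R_{k-1}$ is equal to a block-diagonal direct sum of elements of $\mathcal{Y}_{k-1}$. Complexity. An operation is a single complex multiplication followed by a complex addition; the representations are assumed precomputed and stored in memory. Concretely, one counts the steps of a straight-line program with inputs $(f(s))_{s\in R_n}$, each step forming $a\cdot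 b+c$ where each of $a,b,c$ is an input, a complex constant, or the result of an earlier step; copying or arranging already computed numbers is free. *)

(* Defs.v *)
(* The field of complex numbers is R[i] for R : realType.                     *)
(* Symbols, rows and columns are numbered from 0, so 'I_n stands for          *)
(* {1, ..., n}; contents are unaffected by this shift, and the largest symbol *)
(* n is the one of value n.-1.                                                *)
From HB Require Import structures.
From mathcomp Require Import all_boot all_order all_fingroup all_algebra.
From mathcomp Require Import reals.
From mathcomp Require Export complex.

Set Implicit Arguments.
Unset Strict Implicit.
Unset Printing Implicit Defensive.

Import Order.TTheory GRing.Theory Num.Theory.
Local Open Scope ring_scope.

(** * The rook monoid *)

Definition pinj n (f : {ffun 'I_n -> option 'I_n}) :=
  [forall i, forall j, (f i != None) && (f i == f j) ==> (i == j)].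

Record rook n := Rook { rook_fun :> {ffun 'I_n -> option 'I_n};
                        rook_inj : pinj rook_fun }.

HB.instance Definition _ n := [isSub for @rook_fun n].
HB.instance Definition _ n := [Countable of rook n by <:].
HB.instance Definition _ n := [Finite of rook n by <:].

Lemma pinjP n (f : {ffun 'I_n -> option 'I_n}) :
  reflect (forall i j k, f i = Some k -> f j = Some k -> i = j) (pinj f).
Proof.
apply: (iffP forallP) => [H i j k fi fj|H i].
  by have /forallP/(_ j) := H i; rewrite fi fj eqxx => /eqP.
apply/forallP => j; apply/implyP => /andP[].
by case fi: (f i) => [k|//] _ /eqP fj; apply/eqP/(H i j k).
Qed.

Lemma rook_one_inj n : pinj [ffun i : 'I_n => Some i].
Proof. by apply/pinjP => i j k; rewrite !ffunE => -[->] [->]. Qed.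

Definition rook_one n := Rook (rook_one_inj n).

Lemma rook_mul_inj n (s t : rook n) : pinj [ffun i => obind s (t i)].
Proof.
apply/pinjP => i j k; rewrite !ffunE.
case ti: (t i) => [a|//]; case tj: (t j) => [b|//] /= sa sb.
have ab : a = b by exact: (pinjP _ (rook_inj s)) sa sb.
by apply: (pinjP _ (rook_inj t)) ti _; rewrite ab.
Qed.

(* Maps act on the left: (s t)(i) = s(t(i)). *)
Definition rook_mul n (s t : rook n) := Rook (rook_mul_inj s t).

Lemma rook_tperm_inj n (a b : 'I_n) : pinj [ffun i => Some (tperm a b i)].
Proof.
by apply/pinjP => i j k; rewrite !ffunE => -[<-] [/perm_inj ->].
Qed.

Definition rook_tperm n (a b : 'I_n) := Rook (rook_tperm_inj a b).

Lemma rook_proj_inj n :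
  pinj [ffun i : 'I_n => if i.+1 == n then None else Some i].
Proof.
apply/pinjP => i j k; rewrite !ffunE.
by case: eqP => // _ [->]; case: eqP => // _ [->].
Qed.

(* The idempotent [n]: the identity map restricted to {1, ..., n-1}. *)
Definition rook_proj n := Rook (rook_proj_inj n).

(** * Partitions of 0, ..., n *)

(* A partition of some k <= n has at most n parts, each at most n; it is      *)
(* padded with zeros to exactly n parts.                                      *)
Definition is_partition n (lam : {ffun 'I_n -> 'I_n.+1}) :=
  [forall i : 'I_n, forall j : 'I_n, (i <= j)%N ==> (lam j <= lam i)%N]
  && (\sum_i lam i <= n)%N.

Record young n := Young { parts :> {ffun 'I_n -> 'I_n.+1};
                          youngP : is_partition parts }.

HB.instance Definition _ n := [isSub for @parts n].
HB.instance Definition _ n := [Countable of young n by <:].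
HB.instance Definition _ n := [Finite of young n by <:].

(** * n-standard tableaux *)

Definition box n : Type := ('I_n * 'I_n)%type.

Definition content n (b : box n) : int := b.2%:Z - b.1%:Z.

(* L b is the entry of the box b, and None when b is outside the diagram. *)
Definition filling n := {ffun 'I_n * 'I_n -> option 'I_n}.

Definition entry_lt n (x y : option 'I_n) :=
  if (x, y) is (Some a, Some b) then (a < b)%N else false.

Definition nstandard n (lam : young n) (L : filling n) :=
  [&& [forall b : box n, (L b != None) == (b.2 < lam b.1)%N],
      [forall b : box n, forall b' : box n,
        (L b != None) && (L b == L b') ==> (b == b')],
      [forall b : box n, forall b' : box n,
        [&& L b != None, L b' != None, b.1 == b'.1 & (b.2 < b'.2)%N]
          ==> entry_lt (L b) (L b')]
    & [forall b : box n, forall b' : box n,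
        [&& L b != None, L b' != None, b.2 == b'.2 & (b.1 < b'.1)%N]
          ==> entry_lt (L b) (L b')]].

Record tableau n (lam : young n) :=
  Tableau { tab :> filling n; tabP : nstandard lam tab }.

HB.instance Definition _ n (lam : young n) := [isSub for @tab n lam].
HB.instance Definition _ n (lam : young n) := [Countable of tableau lam by <:].
HB.instance Definition _ n (lam : young n) := [Finite of tableau lam by <:].

Definition tpos n (L : filling n) (x : 'I_n) : option (box n) :=
  [pick b | L b == Some x].

Definition fswap n (a b : 'I_n) (L : filling n) : filling n :=
  [ffun c => omap (tperm a b) (L c)].

(** * Generalized last-letter order *)

Definition pos_before n (p q : option (box n)) :=
  match p, q with
  | None, Some _ => true
  | Some b, Some c => (b.1 < c.1)%N
  | _, None => false
  end.

(* As pos_before is irreflexive, m is the largest symbol whose position       *)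
(* differs; rows are numbered from top to bottom.                             *)
Definition ll_lt n (L L' : filling n) :=
  [exists m : 'I_n, [forall x : 'I_n, (m < x)%N ==> (tpos L x == tpos L' x)]
                    && pos_before (tpos L m) (tpos L' m)].

Definition ll_le n (L L' : filling n) := (L == L') || ll_lt L L'.

Definition ll_enum n (lam : young n) : seq (tableau lam) :=
  sort (relpre (@tab n lam) (@ll_le n)) (enum {: tableau lam}).

Notation tdim lam := #|{: tableau lam}|.

Lemma ll_index_ltn n (lam : young n) (L : tableau lam) :
  (index L (ll_enum lam) < tdim lam)%N.
Proof.
by rewrite cardE -(size_sort (relpre (@tab n lam) (@ll_le n))) index_mem
  mem_sort mem_enum.
Qed.

Definition ll_rank n (lam : young n) (L : tableau lam) : 'I_(tdim lam) :=
  Ordinal (ll_index_ltn L).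

(** * Halverson's representations *)

Section Halverson.
Variables (C : fieldType) (n : nat) (lam : young n).

(* V^lam is the space of column vectors of dimension tdim lam; vtab L is the  *)
(* basis vector v_L.                                                          *)
Definition vtab (L : tableau lam) : 'cV[C]_(tdim lam) :=
  delta_mx (ll_rank L) 0.

(* v_L if L is n-standard, and 0 otherwise. *)
Definition vfill (L : filling n) : 'cV[C]_(tdim lam) :=
  if insub L is Some L' then vtab L' else 0.

(* The action of the transposition (a, b), where a = b - 1. *)
Definition swap_action (a b : 'I_n) (L : tableau lam) : 'cV[C]_(tdim lam) :=
  match tpos L a, tpos L b with
  | Some p, Some q =>
      let c : C := ((content q - content p)%:~R)^-1 in
      c *: vtab L + (1 + c) *: vfill (fswap a b L)
  | None, None => vtab L
  | _, _ => vfill (fswap a b L)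
  end.

Definition proj_action (L : tableau lam) : 'cV[C]_(tdim lam) :=
  if [exists m : 'I_n, (m.+1 == n) && (tpos L m != None)] then 0 else vtab L.

(* The generators determine rho, since they generate the rook monoid. *)
Record halverson (rho : rook n -> 'M[C]_(tdim lam)) : Prop := Halverson {
  halverson1 : rho (rook_one n) = 1%:M;
  halversonM : forall s t, rho (rook_mul s t) = rho s *m rho t;
  halverson_swap : forall (a b : 'I_n) (L : tableau lam), b = a.+1 :> nat ->
    rho (rook_tperm a b) *m vtab L = swap_action a b L;
  halverson_proj : forall L : tableau lam,
    rho (rook_proj n) *m vtab L = proj_action L
}.

End Halverson.

(** * Straight-line programs *)

Section StraightLine.
Variables (I : Type) (C : pzRingType).

Inductive operand := Input of I | Const of C | Result of nat.

(* The step (a, b, c) forms a * b + c. *)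
Definition program := seq (operand * operand * operand).

(* [Result k] is the result of step number k; a reference to a step that has  *)
(* not been executed yet reads 0, that is, it acts as the constant 0.         *)
Definition eval_operand (x : I -> C) (res : seq C) (o : operand) : C :=
  match o with
  | Input i => x i
  | Const c => c
  | Result k => nth 0 res k
  end.

Definition run (x : I -> C) (p : program) : seq C :=
  foldl (fun res st => rcons res (eval_operand x res st.1.1
                                  * eval_operand x res st.1.2
                                  + eval_operand x res st.2)) [::] p.

End StraightLine.

(** * Fourier transforms and their complexity *)

Section Complexity.
Variables (C : fieldType) (n : nat).
Variable Y : forall lam : young n, rook n -> 'M[C]_(tdim lam).

Definition fourier (f : rook n -> C) (lam : young n) : 'M[C]_(tdim lam) :=
  \sum_s f s *: Y lam s.

(* Copying is free: each output is read off any operand, not only a result.   *)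
Definition computes_fourier (p : program (rook n) C) :=
  forall (lam : young n) (i j : 'I_(tdim lam)),
  exists o : operand (rook n) C,
  forall f : rook n -> C, eval_operand f (run f p) o = fourier f lam i j.

Definition fourier_complexity (T : nat) :=
  (exists2 p, computes_fourier p & size p = T)
  /\ (forall p, computes_fourier p -> (T <= size p)%N).

End Complexity.

(* Main.v *)
(* In Halverson's module the basis vector v_L with L filled by the set A is    *)
(* killed by every s undefined somewhere on A, and otherwise s acts on it      *)
(* through its restriction to A. So the transform splits into blocks, one for  *)
(* each pair (A, B) of sets of the same size k; the block is determined by     *)
(* the sums F(t) of f over the extensions s of a bijection t : A -> B. Each s  *)
(* extends 2^(rank s) maps t, so all the F(t) cost at most 2^n |R_n|.          *)
(* After relabelling A and B by 1, ..., k a block is a Fourier transform on    *)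
(* S_k in Young's seminormal form. Decompose S_k into right cosets of S_{k-1}  *)
(* with representatives t_k t_{k-1} ... t_{j+1}: the restriction of a          *)
(* seminormal matrix to S_{k-1} is block diagonal, and each t_i has at most    *)
(* two nonzero entries per column. As the squares of the numbers of standard   *)
(* tableaux of size k add up to at most k!, this costs at most                 *)
(* k! (1*1 + 2*3 + ... + k(2k-1)) operations, and the sum in parentheses is    *)
(* at most (n-1) 2^n for k <= n and n >= 5.                                    *)
Require Import Defs.
From mathcomp Require Import all_boot all_order all_fingroup all_algebra.
From mathcomp Require Import reals complex boolp zify.
Set Implicit Arguments.
Unset Strict Implicit.
Unset Printing Implicit Defensive.

Import Order.TTheory GRing.Theory Num.Theory.
Local Open Scope ring_scope.

(** * Straight-line programs *)

Section Programs.
Variables (I : Type) (C : pzRingType).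
Implicit Types (p q : program I C) (g h : (I -> C) -> C).

(** The bound comes from sharing work between shapes. By [fourier_block], the entry of $\hat f$ at
    (L', L), with L filled by A, L' by B and |A| = |B| = k, is an entry of one transform on $S_k$,
    applied to the sums of f over the extensions of each bijection A -> B; the same transform serves
    all shapes. This rests on [rho_idem], by which the idempotents act diagonally, and on
    [standardizes_exists], which relabels A by 1, ..., k through an element of $S_n$ sending basis
    vectors to basis vectors.

    A tableau filled by 1, ..., k is encoded by its row word, which lists the row of each symbol.
    The seminormal coefficients depend on this word only, so [perm_fourier] can be a coset recursion
    on words, and [word_matrix_fourier] identifies it with the representations. Its entries are
    indexed by pairs of words of equal content, of which there are at most k! by [size_yam_pairs];
    this gives [perm_cost_le].

    At least k! rooks have domain A and image B, so these factorials add up to at most $|R_n|$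
    ([card_blocks]). Together with the extension sums ([card_upper_sums]) the cost is at most
    $|R_n|$ times $2^n + \sum_{i<n} (i+1)(2i+1)$, which [sum_step_costs] bounds. *)

Definition avail p g :=
  exists o : operand I C, forall x, eval_operand x (run x p) o = g x.

Lemma run_rcons x p st : run x (rcons p st) =
  rcons (run x p) (eval_operand x (run x p) st.1.1
                   * eval_operand x (run x p) st.1.2
                   + eval_operand x (run x p) st.2).
Proof. by rewrite /run -cats1 foldl_cat. Qed.

Lemma size_run x p : size (run x p) = size p.
Proof. by elim/last_ind: p => // p st IH; rewrite run_rcons !size_rcons IH. Qed.

Lemma avail_rcons p st g : avail p g -> avail (rcons p st) g.
Proof.
case=> -[i|c|k] Ho; [by exists (Input _ i)|by exists (Const _ c)|].
case: (ltnP k (size p)) => [lt_kp|le_pk].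
  by exists (Result _ _ k) => x; rewrite -Ho /= run_rcons nth_rcons size_run lt_kp.
(* A reference beyond the end reads 0 now but could read the new step, so it is replaced by the
   constant 0. *)
by exists (Const _ 0) => x; rewrite -Ho /= nth_default ?size_run.
Qed.

Lemma avail_cat p q g : avail p g -> avail (p ++ q) g.
Proof.
elim/last_ind: q => [|q st IH]; first by rewrite cats0.
by move=> /IH; rewrite -rcons_cat; exact: avail_rcons.
Qed.

Lemma avail_const p c : avail p (fun=> c).
Proof. by exists (Const _ c). Qed.

Lemma avail_input p i : avail p (fun x => x i).
Proof. by exists (Input _ i). Qed.

Lemma avail_ext p g h : g =1 h -> avail p g -> avail p h.
Proof. by move=> gh [o Ho]; exists o => x; rewrite Ho gh. Qed.

(** Steps are only ever appended, so results keep their numbers and costs add up without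
    renumbering. *)
Definition extends p m (B : ((I -> C) -> C) -> Prop) :=
  exists2 q, (size q <= m)%N & forall g, B g -> avail (p ++ q) g.

Lemma extends_sub p m m' (B B' : ((I -> C) -> C) -> Prop) :
  (m <= m')%N -> (forall g, B' g -> exists2 h, B h & h =1 g) ->
  extends p m B -> extends p m' B'.
Proof.
move=> mm BB [q sq Hq]; exists q; first exact: leq_trans mm.
by move=> g /BB[h Bh hg]; apply: avail_ext hg _; exact: Hq.
Qed.

Lemma extends0 p (B : ((I -> C) -> C) -> Prop) :
  (forall g, B g -> avail p g) -> extends p 0 B.
Proof. by move=> H; exists [::] => // g /H; rewrite cats0. Qed.

Lemma extends_trans p m m' (B B' : ((I -> C) -> C) -> Prop) :
  extends p m B ->
  (forall q, (forall g, B g -> avail (p ++ q) g) -> extends (p ++ q) m' B') ->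
  extends p (m + m') B'.
Proof.
case=> q sq Hq /(_ q Hq)[q' sq' Hq']; exists (q ++ q').
  by rewrite size_cat leq_add.
by rewrite catA.
Qed.

(** The hypothesis speaks of all [p ++ q], because the steps for earlier indices already stand when
    index i is treated. *)
Lemma extends_family (J : eqType) (l : seq J) p (m : J -> nat)
    (B : J -> ((I -> C) -> C) -> Prop) :
  (forall i q, i \in l -> extends (p ++ q) (m i) (B i)) ->
  extends p (\sum_(i <- l) m i) (fun g => exists2 i, i \in l & B i g).
Proof.
elim: l p => [|i l IH] p H; first by rewrite big_nil; apply: extends0 => g [].
rewrite big_cons; have := H i [::]; rewrite mem_head cats0 => /(_ isT) Hi.
have [q sq Hq] := Hi; have [j q'|q' sq' Hq'] := IH (p ++ q).
  by move=> jl; rewrite -catA; apply: H; rewrite inE jl orbT.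
exists (q ++ q'); first by rewrite size_cat leq_add.
move=> g [j]; rewrite inE catA => /predU1P[->|jl] Bg.
  by apply: avail_cat; exact: Hq.
by apply: Hq'; exists j.
Qed.

Lemma extends_lincomb (J : eqType) (l : seq J) p (c : J -> C) (a : J -> (I -> C) -> C) h :
  avail p h -> (forall i, i \in l -> avail p (a i)) ->
  extends p (size l) (eq (fun x => h x + \sum_(i <- l) c i * a i x)).
Proof.
elim: l p h => [|i l IH] p h Hh Ha.
  apply: extends0 => _ <-; apply: avail_ext Hh => x.
  by rewrite big_nil addr0.
have [oi Hi] := Ha i (mem_head _ _); have [oh Hoh] := Hh.
pose p' := rcons p (Const _ (c i), oi, oh).
have [||q sq Hq] := IH p' (fun x => h x + c i * a i x).
- exists (Result _ _ (size p)) => x; rewrite /= run_rcons nth_rcons size_run.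
  by rewrite ltnn eqxx /= Hi Hoh addrC.
- by move=> j jl; apply: avail_rcons; apply: Ha; rewrite inE jl orbT.
exists ((Const _ (c i), oi, oh) :: q); first by rewrite ltnS.
move=> _ <-; rewrite -cat_rcons; apply: avail_ext (Hq _ erefl) => x.
by rewrite big_cons addrA.
Qed.

End Programs.

(** * Counting pairs of standard tableaux *)

Section Words.
Variable N : nat.
Local Open Scope nat_scope.
Implicit Types (mu nu : {ffun 'I_N -> nat}) (w p q : seq 'I_N) (x y : 'I_N).

Definition decreasing_parts mu :=
  [forall r : 'I_N, forall r' : 'I_N, (r <= r') ==> (mu r' <= mu r)].

Lemma decreasing_partsP mu :
  reflect (forall x y, x <= y -> mu y <= mu x) (decreasing_parts mu).
Proof.
apply: (iffP forallP) => H x; first by move=> y; apply/implyP/(forallP (H x)).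
by apply/forallP => y; apply/implyP/H.
Qed.

Definition incr mu x := [ffun r => mu r + (r == x)].
(** Subtraction is truncated: an empty row is left unchanged, hence the guards [0 < mu x] below. *)
Definition decr mu x := [ffun r => mu r - (r == x)].

Definition content_of w : {ffun 'I_N -> nat} := [ffun r => count_mem r w].

Lemma content_rcons w x : content_of (rcons w x) = incr (content_of w) x.
Proof.
apply/ffunP => r; rewrite !ffunE -cats1 count_cat /= addn0.
by rewrite [x == r]eq_sym.
Qed.

(** These words encode the standard tableaux of size k with at most N rows: each letter is the row
    of the corresponding symbol. *)
Fixpoint yamanouchi k : seq (seq 'I_N) :=
  if k is k'.+1 then
    [seq w <- [seq rcons w x | w <- yamanouchi k', x <- enum 'I_N]
       | decreasing_parts (content_of w)]
  else [:: [::]].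

Lemma yamanouchi_rcons k w x : (rcons w x \in yamanouchi k.+1) =
  (w \in yamanouchi k) && decreasing_parts (content_of (rcons w x)).
Proof.
rewrite mem_filter andbC; congr (_ && _); apply/allpairsP/idP => [[[v y]]|Hw].
  by case=> /= Hv _ /rcons_inj[-> _].
by exists (w, x); rewrite mem_enum.
Qed.

Lemma yamanouchi_size k w : w \in yamanouchi k -> size w = k.
Proof.
elim: k w => [|k IH] w; first by rewrite inE => /eqP ->.
case/lastP: w => [|w x].
  rewrite mem_filter => /andP[_ /allpairsP[[v y] [_ _]]].
  by move/(congr1 size); rewrite size_rcons.
by rewrite yamanouchi_rcons size_rcons => /andP[/IH ->].
Qed.

Lemma yamanouchi_take k w : w \in yamanouchi k.+1 -> take k w \in yamanouchi k.
Proof.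
case/lastP: w => [/yamanouchi_size //|w x].
rewrite yamanouchi_rcons => /andP[Hw _].
by rewrite -cats1 -(yamanouchi_size Hw) take_size_cat // (yamanouchi_size Hw).
Qed.

Lemma yamanouchiP k w :
  reflect (size w = k /\ forall i, i <= k -> decreasing_parts (content_of (take i w)))
          (w \in yamanouchi k).
Proof.
elim: k w => [|k IH] w.
  rewrite inE; apply: (iffP eqP) => [->|[/size0nil //]]; split => // i _.
  by apply/decreasing_partsP => x y _; rewrite !ffunE.
case/lastP: w => [|w x].
  by apply: (iffP idP) => [/yamanouchi_size //|[]].
rewrite yamanouchi_rcons size_rcons; apply: (iffP andP) => [[/IH[sw Hw] Hx]|].
  rewrite sw; split => // i; rewrite leq_eqVlt => /predU1P[->|].
    by rewrite -sw -(size_rcons w x) take_size.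
  by rewrite ltnS => ik; rewrite -cats1 takel_cat ?sw //; apply: Hw.
case=> -[sw] Hw; split; last first.
  by have := Hw k.+1 (leqnn _); rewrite -sw -(size_rcons w x) take_size.
apply/IH; split=> // i ik; have := Hw i (leqW ik).
by rewrite -cats1 takel_cat ?sw.
Qed.

Lemma sum_yamanouchiS k (H : seq 'I_N -> nat) :
  \sum_(w <- yamanouchi k.+1) H w =
  \sum_(w <- yamanouchi k) \sum_(x | decreasing_parts (incr (content_of w) x))
     H (rcons w x).
Proof.
rewrite big_filter big_mkcond big_allpairs_dep /=; apply: eq_bigr => w _.
rewrite big_enum [RHS]big_mkcond /=; apply: eq_bigr => x _.
by rewrite content_rcons.
Qed.

(** This is $f^\mu$, the number of standard tableaux of shape mu, if mu is a partition of k, and 0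
    otherwise. *)
Definition yam_count k mu := \sum_(w <- yamanouchi k) (content_of w == mu).

Lemma incr_eq nu mu x : (incr nu x == mu) = (0 < mu x) && (nu == decr mu x).
Proof.
apply/eqP/andP => [<-|[mx /eqP ->]].
  by rewrite ffunE eqxx addn1; split=> //; apply/eqP/ffunP => r; rewrite !ffunE addnK.
apply/ffunP => r; rewrite !ffunE; have [->|_] := eqVneq r x.
  by rewrite subnK.
by rewrite subn0 addn0.
Qed.

(** Branching rule: delete the box of the largest symbol. Rows whose shortening breaks the shape
    contribute 0. *)
Lemma yam_countS k mu : decreasing_parts mu ->
  yam_count k.+1 mu = \sum_(x | 0 < mu x) yam_count k (decr mu x).
Proof.
move=> pm; rewrite /yam_count sum_yamanouchiS exchange_big /=.
apply: eq_bigr => w _; rewrite big_mkcond [RHS]big_mkcond; apply: eq_bigr => x _.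
rewrite content_rcons incr_eq; case: (ltnP 0 (mu x)) => mx /=; last by case: ifP.
case: eqP => [->|_]; last by case: ifP.
have /eqP -> : incr (decr mu x) x == mu by rewrite incr_eq mx eqxx.
by rewrite pm.
Qed.

Lemma yam_count_eq0 k mu : ~~ decreasing_parts mu -> yam_count k mu = 0.
Proof.
move=> pm; rewrite /yam_count big_seq big1 // => w Hw.
apply/eqP; rewrite eqb0; apply: contra pm => /eqP <-.
have /yamanouchiP[sw] := Hw; move/(_ k (leqnn _)).
by rewrite take_oversize ?sw.
Qed.

Definition removable mu x := (0 < mu x) && decreasing_parts (decr mu x).

Lemma addableE mu x : decreasing_parts mu ->
  decreasing_parts (incr mu x) = [forall r : 'I_N, (r < x) ==> (mu x < mu r)].
Proof.
move/decreasing_partsP => pm; apply/decreasing_partsP/forallP => H.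
  move=> r; apply/implyP => rx; have := H _ _ (ltnW rx); rewrite !ffunE eqxx.
  by rewrite -[r == x]val_eqE (ltn_eqF rx) addn1 addn0.
move=> a b ab; rewrite !ffunE; have := pm _ _ ab.
have [bx|_] := eqVneq b x; last by rewrite addn0; lia.
have [->|ax] := eqVneq a x; first by rewrite bx.
have alt : a < x by rewrite ltn_neqAle -bx ab andbT bx.
by have := H a; rewrite alt bx /= => ?; lia.
Qed.

Lemma removableE mu x : decreasing_parts mu ->
  removable mu x = (0 < mu x) && [forall r : 'I_N, (x < r) ==> (mu r < mu x)].
Proof.
move/decreasing_partsP => pm; rewrite /removable; case: ltnP => //= mx.
apply/decreasing_partsP/forallP => H.
  move=> r; apply/implyP => rx; have := H _ _ (ltnW rx); rewrite !ffunE eqxx.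
  by rewrite -[r == x]val_eqE (gtn_eqF rx); lia.
move=> a b ab; rewrite !ffunE; have := pm _ _ ab.
have [ax|_] := eqVneq a x; last by rewrite subn0; lia.
have [->|bx] := eqVneq b x; first by rewrite ax.
have alt : x < b by rewrite ltn_neqAle -ax ab andbT ax eq_sym.
by have := H b; rewrite alt ax /= => ?; lia.
Qed.

(* Sending an addable row r > 0 to the row above it gives a removable row.    *)
Lemma card_addable mu : decreasing_parts mu ->
  #|[pred x | decreasing_parts (incr mu x)]| <= #|[pred x | removable mu x]|.+1.
Proof.
move=> pm; have /decreasing_partsP dm := pm.
pose up (x : 'I_N) : 'I_N := Ordinal (leq_ltn_trans (leq_pred x) (ltn_ord x)).
pose A := [set x | decreasing_parts (incr mu x)].
rewrite -(cardsE [pred x | decreasing_parts (incr mu x)]) -/A.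
rewrite -(cardsID [set x : 'I_N | x == 0 :> nat]) -addn1 addnC leq_add //.
  have inj : {in A :\: [set x : 'I_N | x == 0 :> nat] &, injective up}.
    move=> x y; rewrite !inE => /andP[x0 _] /andP[y0 _] /(congr1 val) /= xy.
    by apply/val_inj => /=; lia.
  rewrite -(card_in_imset inj); apply/subset_leq_card/subsetP => _ /imsetP[x + ->].
  rewrite !inE addableE // removableE // => /andP[x0 /forallP Hx].
  have Hup : mu x < mu (up x) by apply: (implyP (Hx (up x))); rewrite /=; lia.
  rewrite (leq_trans _ Hup) //=; apply/forallP => r; apply/implyP => rx.
  by apply: leq_ltn_trans Hup; apply: dm; rewrite /= in rx; lia.
apply: leq_trans (_ : #|[set x : 'I_N | x == 0 :> nat]| <= 1).
  exact/subset_leq_card/subsetIr.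
apply/card_le1_eqP => x y; rewrite !inE => /eqP x0 /eqP y0.
by apply/val_inj; rewrite /= x0 y0.
Qed.

Lemma incr_decrC mu x y : x != y -> incr (decr mu y) x = decr (incr mu x) y.
Proof.
move=> xy; apply/ffunP => r; rewrite !ffunE.
have [->|_] := eqVneq r x; last by rewrite !addn0.
by rewrite (negbTE xy) !subn0.
Qed.

Lemma incr_decrK mu x : 0 < mu x -> incr (decr mu x) x = mu.
Proof. by move=> mx; apply/eqP; rewrite incr_eq mx eqxx. Qed.

Lemma decr_incrK mu x : decr (incr mu x) x = mu.
Proof. by apply/ffunP => r; rewrite !ffunE addnK. Qed.

(** Adding to row x is tested against the rows above it, and the box lost by row y can only make
    this test harder; dually for removing from row y. *)
Lemma moved_parts mu x y : decreasing_parts mu ->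
  x != y -> 0 < mu y -> decreasing_parts (incr (decr mu y) x) ->
  decreasing_parts (incr mu x) && removable mu y.
Proof.
move=> pm xy my /decreasing_partsP H; rewrite addableE // removableE // my /=.
apply/andP; split; apply/forallP => r; apply/implyP => rx.
  have := H _ _ (ltnW rx); rewrite !ffunE eqxx (negbTE xy).
  by rewrite -[r == x]val_eqE (ltn_eqF rx); case: (r == y); lia.
have := H _ _ (ltnW rx); rewrite !ffunE eqxx [y == x]eq_sym (negbTE xy).
by rewrite -[r == y]val_eqE (gtn_eqF rx); case: (r == x); lia.
Qed.

Definition yam_moves k mu :=
  \sum_(x : 'I_N) \sum_(y | (x != y) && (0 < mu y)) yam_count k (incr (decr mu y) x).

(** Apply the branching rule to each enlarged shape: removing the box just added returns mu, and the
    other removals are the moves. *)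
Lemma yam_count_up_aux k mu : decreasing_parts mu ->
  \sum_(x : 'I_N) yam_count k.+1 (incr mu x) =
  #|[pred x | decreasing_parts (incr mu x)]| * yam_count k mu + yam_moves k mu.
Proof.
move=> pm; rewrite /yam_moves -sum1_card big_distrl /= [in RHS]big_mkcond -big_split /=.
apply: eq_bigr => x _; rewrite inE; case: ifP => px.
  rewrite yam_countS // (bigD1 x) ?ffunE ?eqxx ?addn1 //= decr_incrK mul1n; congr (_ + _).
  apply: eq_big => [y|y /andP[_ xy]].
    by rewrite ffunE andbC eq_sym; case: eqVneq => // xy; rewrite addn0.
  by rewrite incr_decrC // eq_sym.
rewrite yam_count_eq0 ?px // big1 // => y /andP[xy my].
apply: yam_count_eq0; apply/negP => /(moved_parts pm xy my).
by rewrite px.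
Qed.

(* Adding and then removing a box differs from removing and then adding one    *)
(* only in the moves that return to mu, counted by its addable, respectively   *)
(* removable, rows: this is the relation UD - DU = 1 of Young's lattice.       *)
Lemma yam_count_moves k mu : decreasing_parts mu ->
  #|[pred x | removable mu x]| * yam_count k mu + yam_moves k mu <= k * yam_count k mu.
Proof.
elim: k mu => [|k IH] mu pm.
  rewrite mul0n leqn0 addn_eq0; apply/andP; split.
    rewrite /yam_count big_seq1;
    have [<-|_] := eqVneq (content_of [::]) mu; last by rewrite muln0.
    by rewrite muln1; apply/eqP/eq_card0 => x; rewrite inE /removable ffunE.
  rewrite /yam_moves big1 // => x _; rewrite big1 // => y _.
  rewrite /yam_count big_seq1; case: eqP => // /ffunP/(_ x).
  by rewrite !ffunE eqxx addn1.
have up nu : decreasing_parts nu ->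
    \sum_x yam_count k.+1 (incr nu x) <= k.+1 * yam_count k nu.
  move=> pn; rewrite yam_count_up_aux //.
  apply: (@leq_trans (#|[pred x | removable nu x]|.+1 * yam_count k nu + yam_moves k nu)).
    by rewrite leq_add2r leq_mul2r card_addable ?orbT.
  by rewrite !mulSn -addnA leq_add2l IH.
(* Remove a box from row y and add one to row x: x = y returns mu once per removable y, and the
   other x give the moves. Then [up] applies to each [decr mu y]. *)
rewrite [in leqRHS]yam_countS // [leqRHS]big_distrr /=.
apply: (@leq_trans
  (\sum_(y | removable mu y) \sum_x yam_count k.+1 (incr (decr mu y) x))).
  have -> : yam_moves k.+1 mu = \sum_(y | removable mu y)
      \sum_(x | x != y) yam_count k.+1 (incr (decr mu y) x).
    rewrite /yam_moves (exchange_big_dep xpredT) //= [RHS]big_mkcond.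
    apply: eq_bigr => y _; case: ifP => [/andP[my _]|ry].
      by apply: eq_bigl => x; rewrite my andbT.
    apply: big1 => x /andP[xy my]; apply: yam_count_eq0; apply/negP.
    by move=> /(moved_parts pm xy my); rewrite ry andbF.
  rewrite -sum1_card big_distrl /= -big_split /=; apply: leq_sum => y /andP[my _].
  by rewrite [leqRHS](bigD1 y) //= incr_decrK // mul1n.
rewrite [leqRHS](bigID (fun y => decreasing_parts (decr mu y))) /=.
rewrite -[leqLHS]addn0 leq_add //.
by apply: leq_sum => y /andP[my py]; apply: up.
Qed.

(** In Young's lattice this is an equality; with only N rows available an addable row may be
    missing. *)
Lemma yam_count_up k mu : decreasing_parts mu ->
  \sum_(x : 'I_N) yam_count k.+1 (incr mu x) <= k.+1 * yam_count k mu.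
Proof.
move=> pm; rewrite yam_count_up_aux //.
apply: (@leq_trans (#|[pred x | removable mu x]|.+1 * yam_count k mu + yam_moves k mu)).
  by rewrite leq_add2r leq_mul2r card_addable ?orbT.
by rewrite !mulSn -addnA leq_add2l yam_count_moves.
Qed.

Definition yam_pairs k : seq (seq 'I_N * seq 'I_N) :=
  [seq pq <- [seq (p, q) | p <- yamanouchi k, q <- yamanouchi k]
     | content_of pq.1 == content_of pq.2].

Lemma mem_yam_pairs k p q : ((p, q) \in yam_pairs k) =
  [&& p \in yamanouchi k, q \in yamanouchi k & content_of p == content_of q].
Proof.
rewrite mem_filter /= andbC andbA; congr (_ && _).
by apply/allpairsP/andP => [[[v w] /= [Hv Hw [-> ->]]]|[Hp Hq]]; last exists (p, q).
Qed.

(** The pairs number the sum of the $(f^\mu)^2$. Strip the last letter of one word and apply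
    [yam_count_up] to the count of the other: each level gains at most a factor k + 1. *)
Lemma size_yam_pairs k : size (yam_pairs k) <= k`!.
Proof.
have sumE j : size (yam_pairs j) = \sum_(w <- yamanouchi j) yam_count j (content_of w).
  rewrite size_filter -sum1_count big_mkcond big_allpairs_dep /=.
  apply: eq_bigr => w _; apply: eq_bigr => v _.
  by rewrite eq_sym; case: eqP.
rewrite sumE; elim: k => [|k IH].
  by rewrite big_seq1 /yam_count big_seq1 eqxx.
rewrite sum_yamanouchiS factS; apply: leq_trans (leq_mul (leqnn _) IH).
rewrite big_distrr /= big_seq [leqRHS]big_seq; apply: leq_sum => w Hw.
have /yamanouchiP[sw /(_ _ (leqnn _))] := Hw; rewrite take_oversize ?sw // => pw.
apply: leq_trans (yam_count_up k pw).
rewrite [leqRHS](bigID (fun x => decreasing_parts (incr (content_of w) x))) /=.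
rewrite -[leqLHS]addn0 leq_add //.
by apply: leq_sum => x _; rewrite content_rcons.
Qed.
End Words.

(** * The transform on the symmetric group *)

Section Transform.
Variables (n : nat) (C : fieldType).
Implicit Types (p q w u : seq 'I_n) (X : seq 'I_n -> seq 'I_n -> C).

Definition swap_word j w :=
  if drop j w is x :: y :: r then take j w ++ [:: y, x & r] else w.

Lemma content_swap_word j w : content_of (swap_word j w) = content_of w.
Proof.
rewrite /swap_word; case E: (drop j w) => [|x [|y r]] //.
rewrite -[in RHS](cat_take_drop j w) E.
by apply/ffunP => z; rewrite !ffunE !count_cat /=; congr (_ + _)%N; exact: addnCA.
Qed.

(* The content of the box filled by the letter x after the prefix u. *)
Definition word_content u (x : 'I_n) : int := (count_mem x u)%:Z - x%:Z.

(* Right multiplication by the seminormal matrix of (j, j + 1), on matrices     *)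
(* indexed by row words.                                                       *)
Definition swap_op j X p q : C :=
  if drop j q is x :: y :: r then
    let c : C :=
      ((word_content (rcons (take j q) x) y - word_content (take j q) x)%:~R)^-1 in
    c * X p q + (if (x != y) && (swap_word j q \in yamanouchi n (size q))
                 then (1 + c) * X p (swap_word j q) else 0)
  else 0.

(** Block-diagonal extension from $S_k$ to $S_{k+1}$: on words of length k + 1, the last letter
    names the block. *)
Definition lift_op k X p q : C :=
  if drop k p == drop k q then X (take k p) (take k q) else 0.

Fixpoint cycle_op k i X : seq 'I_n -> seq 'I_n -> C :=
  if i is i'.+1 then swap_op (k - i'.+1) (cycle_op k i' X) else X.

Definition adj j : 'S_n :=
  if (insub j, insub j.+1) is (Some a, Some b) then tperm a b else 1%g.

(* The cycle k - i |-> k - i + 1 |-> ... |-> k |-> k - i. *)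
Fixpoint cyc k i : 'S_n :=
  if i is i'.+1 then (adj (k - i'.+1) * cyc k i')%g else 1%g.

Fixpoint perm_fourier k (g : 'S_n -> C) : seq 'I_n -> seq 'I_n -> C :=
  if k is k'.+1 then fun p q =>
    \sum_(i < k'.+1)
      cycle_op k' i (lift_op k' (perm_fourier k' (fun s => g (cyc k' i * s)%g))) p q
  else fun _ _ => g 1%g.

(** Besides the k subtransforms, each of the k cosets is charged at most k - 1 swaps of two
    operations per entry and one addition per entry. *)
Fixpoint perm_cost k : nat :=
  if k is k'.+1 then
    (k * perm_cost k' + k * (2 * k' + 1) * size (yam_pairs n k))%N
  else 0%N.

Lemma yam_pairs_lift k p q : (p, q) \in yam_pairs n k.+1 ->
  drop k p == drop k q -> (take k p, take k q) \in yam_pairs n k.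
Proof.
rewrite !mem_yam_pairs => /and3P[Hp Hq /eqP/ffunP pq] /eqP dpq.
rewrite !yamanouchi_take //=; apply/eqP/ffunP => r; have := pq r.
rewrite !ffunE -{1}(cat_take_drop k p) -{1}(cat_take_drop k q) !count_cat dpq.
exact: addIn.
Qed.

Lemma yam_pairs_swap k j p q : (p, q) \in yam_pairs n k ->
  swap_word j q \in yamanouchi n (size q) -> (p, swap_word j q) \in yam_pairs n k.
Proof.
rewrite !mem_yam_pairs content_swap_word => /and3P[-> Hq ->].
by rewrite (yamanouchi_size Hq) => ->.
Qed.

Section Cost.
Variable I : Type.
Implicit Types (P : program I C).

Definition computed k (V : (I -> C) -> seq 'I_n -> seq 'I_n -> C) P :=
  forall p q, (p, q) \in yam_pairs n k -> avail P (fun f => V f p q).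

Definition pair_values k (V : (I -> C) -> seq 'I_n -> seq 'I_n -> C) :=
  fun h => exists2 pq, pq \in yam_pairs n k & h = (fun f => V f pq.1 pq.2).

(** Each entry combines at most two known entries with constant coefficients. *)
Lemma extends_swap_op k j V P : computed k V P ->
  extends P (2 * size (yam_pairs n k)) (pair_values k (fun f => swap_op j (V f))).
Proof.
move=> HV.
apply: extends_sub (extends_family (l := yam_pairs n k) (m := fun=> 2%N)
  (B := fun pq h => h = (fun f => swap_op j (V f) pq.1 pq.2)) _) => //.
- by rewrite big_const_seq count_predT iter_addn_0.
- by move=> _ [pq Hpq ->]; exists (fun f => swap_op j (V f) pq.1 pq.2) => //; exists pq.
move=> [p q] Q Hpq /=; rewrite /swap_op.
case E: (drop j q) => [|x [|y r]].
- by apply: extends_sub (extends0 (B := fun h => h = fun=> 0) _) => // [_ ->|_ ->];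
    [exists (fun=> 0)|exact: avail_const].
- by apply: extends_sub (extends0 (B := fun h => h = fun=> 0) _) => // [_ ->|_ ->];
    [exists (fun=> 0)|exact: avail_const].
set c := (_^-1); set G := (_ && _).
apply: extends_sub (@extends_lincomb _ _ _ [:: true; false] _
  (fun b => if b then c else if G then 1 + c else 0)
  (fun b f => if b then V f p q else if G then V f p (swap_word j q) else 0)
  _ (avail_const _ 0) _) => // [_ ->|].
  eexists; first by [].
  by move=> f /=; rewrite big_cons big_seq1 add0r; case: (G); rewrite ?mul0r.
case=> _; first by apply: avail_cat; exact: HV.
case EG: G; last exact: avail_const.
apply: avail_cat; apply: HV; apply: yam_pairs_swap => //.
by case/andP: EG.
Qed.

Lemma extends_cycle_op k k' i V P : computed k V P ->
  extends P (i * (2 * size (yam_pairs n k)))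
    (pair_values k (fun f => cycle_op k' i (V f))).
Proof.
move=> HV; elim: i => [|i IH] /=.
  by apply: extends0 => _ [[p q] Hpq ->]; exact: HV.
rewrite mulSn addnC; apply: extends_trans IH _ => Q HQ.
apply: extends_swap_op => p q Hpq; apply: HQ.
by exists (p, q).
Qed.

(** The transformed function is any family of available values, so shifting it by a coset
    representative is free. *)
Lemma extends_perm_fourier k P (G : 'S_n -> (I -> C) -> C) :
  (forall s, avail P (G s)) ->
  extends P (perm_cost k) (pair_values k (fun f => perm_fourier k (G^~ f))).
Proof.
elim: k P G => [|k IH] P G HG.
  by apply: extends0 => _ [pq _ ->] /=; exact: HG.
pose Z i f := lift_op k (perm_fourier k (fun s => G (cyc k i * s)%g f)).
set D := yam_pairs n k.+1.
have term i Q : extends (P ++ Q) (perm_cost k + i * (2 * size D))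
    (pair_values k.+1 (fun f => cycle_op k i (Z i f))).
  apply: extends_trans (IH (P ++ Q) (fun s => G (cyc k i * s)%g) _) _.
    by move=> s; apply: avail_cat; exact: HG.
  move=> Q' HQ'; apply: extends_cycle_op => p q Hpq; rewrite /Z /lift_op.
  case Epq: (drop k p == drop k q); last exact: avail_const.
  by apply: HQ'; exists (take k p, take k q) => //; exact: yam_pairs_lift.
pose S pq f := 0 + \sum_(i <- enum 'I_k.+1) 1 * cycle_op k i (Z i f) pq.1 pq.2.
apply: extends_sub (_ : extends P (\sum_(i < k.+1) (perm_cost k + i * (2 * size D))
  + \sum_(pq <- D) size (enum 'I_k.+1))
    (fun g => exists2 pq, pq \in D & S pq = g)) => [|h Hh|]; last first.
- apply: (extends_trans (extends_family (l := index_enum 'I_k.+1)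
    (fun i Q (_ : i \in index_enum 'I_k.+1) => term i Q))) => Q HQ.
  apply: (extends_family (l := D) (m := fun=> size (enum 'I_k.+1))).
  move=> [p q] Q' Hpq.
  refine (@extends_lincomb I C 'I_k.+1 (enum 'I_k.+1) _ (fun=> 1)
   (fun i f => cycle_op k i (Z i f) p q) (fun=> 0) (avail_const _ 0) _).
  move=> i _; apply: avail_cat; apply: HQ; exists i; first exact: mem_index_enum.
  by exists (p, q).
- have [[p q] Hpq ->] := Hh; exists (S (p, q)); first by exists (p, q).
  move=> f; rewrite /S add0r big_enum /=.
  by apply: eq_bigr => i _; rewrite mul1r.
- have -> : (\sum_(pq <- D) size (enum 'I_k.+1) = size D * k.+1)%N.
    by rewrite big_const_seq count_predT iter_addn_0 size_enum_ord mulnC.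
  have : (\sum_(i < k.+1) (perm_cost k + i * (2 * size D)) <=
          \sum_(i < k.+1) (perm_cost k + k * (2 * size D)))%N.
    by apply: leq_sum => i _; rewrite leq_add2l leq_mul2r -ltnS ltn_ord orbT.
  rewrite sum_nat_const card_ord /= => H.
  by apply: leq_trans (leq_add H (leqnn _)) _; rewrite -/D; lia.
Qed.
Lemma perm_cost_le k :
  (perm_cost k <= k`! * \sum_(i < k) i.+1 * (2 * i + 1))%N.
Proof.
elim: k => [|k IH]; first by rewrite big_ord0.
rewrite big_ord_recr /= [leqRHS]mulnDr leq_add //.
  by rewrite factS -mulnA leq_mul2l IH.
by rewrite [leqRHS]mulnC leq_mul2l size_yam_pairs orbT.
Qed.
End Cost.

End Transform.

(** * Tableaux and row words *)

Section Tableaux.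
Variables (n : nat) (lam : young n).
Implicit Types (L P Q : tableau lam) (b : box n) (x y : 'I_n).

Lemma partsP (r r' : 'I_n) : (r <= r')%N -> (lam r' <= lam r)%N.
Proof. by have /andP[/forallP/(_ r)/forallP/(_ r')/implyP] := youngP lam. Qed.

Lemma tab_dom L b : (tab L b != None) = (b.2 < lam b.1)%N.
Proof. by have /and4P[/forallP/(_ b)/eqP] := tabP L. Qed.

Lemma tab_inj L b b' x : tab L b = Some x -> tab L b' = Some x -> b = b'.
Proof.
have /and4P[_ /forallP/(_ b)/forallP/(_ b') H _ _] := tabP L.
by move=> Lb Lb'; move: H; rewrite Lb Lb' eqxx => /eqP.
Qed.

Lemma tab_row L b b' x y : tab L b = Some x -> tab L b' = Some y ->
  b.1 = b'.1 -> (b.2 < b'.2)%N -> (x < y)%N.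
Proof.
have /and4P[_ _ /forallP/(_ b)/forallP/(_ b') H _] := tabP L.
by move=> Lb Lb' r c; move: H; rewrite Lb Lb' r c eqxx.
Qed.

Lemma tab_col L b b' x y : tab L b = Some x -> tab L b' = Some y ->
  b.2 = b'.2 -> (b.1 < b'.1)%N -> (x < y)%N.
Proof.
have /and4P[_ _ _ /forallP/(_ b)/forallP/(_ b') H] := tabP L.
by move=> Lb Lb' r c; move: H; rewrite Lb Lb' r c eqxx.
Qed.

Lemma tposE L x b : (tpos L x == Some b) = (tab L b == Some x).
Proof.
rewrite /tpos; case: pickP => [b' /eqP Lb'|/(_ b) -> //].
apply/eqP/eqP => [[<-] //|Lb]; congr Some; exact: tab_inj Lb' Lb.
Qed.

Lemma tposP L x b : tpos L x = Some b <-> tab L b = Some x.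
Proof. by split=> /eqP; [rewrite tposE|rewrite -tposE] => /eqP. Qed.

Definition symbols (F : filling n) : {set 'I_n} := [set x | tpos F x != None].

(** An absent symbol gets itself as dummy row, a value independent of the tableau;
    [drop_row_word_filled] relies on this. *)
Definition row_of (F : filling n) x : 'I_n :=
  if tpos F x is Some b then b.1 else x.

Definition row_word (F : filling n) : seq 'I_n := [seq row_of F x | x <- enum 'I_n].

Lemma size_row_word F : size (row_word F) = n.
Proof. by rewrite size_map size_enum_ord. Qed.

Lemma take_enum_ord m : take m (enum 'I_n) = [seq x : 'I_n <- enum 'I_n | (x < m)%N].
Proof.
apply: (inj_map val_inj); rewrite map_take val_enum_ord take_iota.
transitivity [seq i <- map (@nat_of_ord n) (enum 'I_n) | (i < m)%N]; last first.
  by rewrite filter_map.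
rewrite [map _ _]val_enum_ord.
have [mn|nm] := leqP m n.
  by rewrite (@filter_iota_ltn 0).
apply/esym/all_filterP/allP => i.
by rewrite mem_iota => /andP[_ /ltn_trans ->].
Qed.

Lemma card_set_count (a : pred 'I_n) : #|[set x | a x]| = count a (enum 'I_n).
Proof. by rewrite cardsE cardE size_filter enumT. Qed.

Lemma card_set_ltn m : (m <= n)%N -> #|[set x : 'I_n | (x < m)%N]| = m.
Proof.
move=> mn; rewrite card_set_count -size_filter -take_enum_ord.
by rewrite size_takel // size_enum_ord.
Qed.

Definition row_count (F : filling n) m (r : 'I_n) :=
  #|[set c | if F (r, c) is Some x then (x < m)%N else false]|.

Lemma count_row_word L m r : (forall x, (x < m)%N -> x \in symbols L) ->
  count_mem r (take m (row_word L)) = row_count L m r.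
Proof.
move=> Hm; rewrite -map_take take_enum_ord count_map count_filter.
transitivity #|[set x | (row_of L x == r) && (x < m)%N]|.
  by rewrite card_set_count; apply: eq_count.
pose e c := odflt c (tab L (r, c)).
rewrite /row_count -[RHS](card_in_imset (f := e)); last first.
  move=> c c'; rewrite !inE /e.
  case E: (tab L (r, c)) => [x|//] _; case E': (tab L (r, c')) => [y|//] _ /= xy.
  by have := tab_inj E; rewrite xy => /(_ _ E')[].
apply: eq_card => x; rewrite !inE; apply/andP/imsetP => [[/eqP rx xm]|[c]].
  have := Hm _ xm; rewrite inE; move: rx; rewrite /row_of.
  case Lx: (tpos L x) => [[r' c]|//] /= rr _.
  by move/tposP: Lx; rewrite rr => Lx; exists c; rewrite ?inE /e Lx.
rewrite inE /e; case E: (tab L (r, c)) => [y|//] ym -> /=; split => //.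
by move/tposP: E; rewrite /row_of => ->.
Qed.

(** As rows increase, the smaller entries in the row of x are those to its left, so row words
    determine columns. *)
Lemma row_count_pos L x r c : tpos L x = Some (r, c) -> row_count L x r = c.
Proof.
move=> /tposP Lx; transitivity #|[set c' : 'I_n | (c' < c)%N]|; last first.
  by rewrite card_set_ltn // ltnW.
apply: eq_card => c'; rewrite !inE; case E: (tab L (r, c')) => [y|].
  case: (ltngtP c' c) => cc.
  - exact: tab_row E Lx _ _.
  - by apply/negbTE; rewrite -leqNgt ltnW //; apply: tab_row Lx E _ _.
  - have ec : c' = c by apply/val_inj.
    by move: E; rewrite ec Lx => -[->]; rewrite ltnn.
apply/esym/negbTE/negP => cc.
have := tab_dom L (r, c); rewrite Lx => /esym /= cl.
by have := tab_dom L (r, c'); rewrite E eqxx /= (ltn_trans cc cl).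
Qed.

Lemma row_count_decreasing L m (r r' : 'I_n) : (r <= r')%N ->
  (row_count L m r' <= row_count L m r)%N.
Proof.
rewrite leq_eqVlt => /predU1P[/val_inj -> //|rr].
apply/subset_leq_card/subsetP => c; rewrite !inE.
case E: (tab L (r', c)) => [y|//] ym; case E': (tab L (r, c)) => [x|].
  by apply: ltn_trans ym; apply: tab_col E' E _ _.
have := tab_dom L (r, c); rewrite E' eqxx /= => /esym/negbT.
rewrite -leqNgt => lc; have := tab_dom L (r', c); rewrite E /= => /esym.
by rewrite ltnNge (leq_trans (partsP (ltnW rr)) lc).
Qed.

Definition filled k L := forall x, (x \in symbols L) = (x < k)%N.

Lemma row_count_filled k L r : filled k L ->
  row_count L k r = #|[set c : 'I_n | (c < lam r)%N]|.
Proof.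
move=> fL; apply: eq_card => c; rewrite !inE.
have := tab_dom L (r, c); case E: (tab L (r, c)) => [x|] /= <- //.
by rewrite -fL inE; move/tposP: E => ->.
Qed.

Lemma row_word_yamanouchi k m L : filled k L -> (m <= k)%N -> (k <= n)%N ->
  take m (row_word L) \in yamanouchi n m.
Proof.
move=> fL mk kn; apply/yamanouchiP; split=> [|i im].
  by rewrite size_takel // size_row_word (leq_trans mk).
rewrite take_takel //; apply/decreasing_partsP => x y xy; rewrite !ffunE.
have H (z : 'I_n) : (z < i)%N -> z \in symbols L.
  by rewrite fL => /leq_trans; apply; apply: leq_trans mk.
by rewrite !count_row_word // row_count_decreasing.
Qed.

Lemma row_word_content k P Q : filled k P -> filled k Q ->
  content_of (take k (row_word P)) = content_of (take k (row_word Q)).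
Proof.
move=> fP fQ; apply/ffunP => r; rewrite !ffunE.
by rewrite !count_row_word ?(row_count_filled _ fP) ?(row_count_filled _ fQ) //
  => x; rewrite ?fP ?fQ.
Qed.

Lemma nth_row_word F x0 x : nth x0 (row_word F) x = row_of F x.
Proof. by rewrite (nth_map x0) ?size_enum_ord // nth_ord_enum. Qed.

(** A letter gives the row of its symbol, and the number of earlier equal letters gives the
    column. *)
Lemma row_word_inj k P Q : filled k P -> filled k Q ->
  row_word P = row_word Q -> P = Q.
Proof.
move=> fP fQ PQ.
suff H (S T : tableau lam) : filled k S -> filled k T -> row_word S = row_word T ->
    forall b x, tab S b = Some x -> tab T b = Some x.
  apply/val_inj/ffunP => b; case E: (tab P b) => [x|].
    by rewrite (H _ _ fP fQ PQ _ _ E).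
  case E' : (tab Q b) => [x|//].
  by rewrite (H _ _ fQ fP (esym PQ) _ _ E') in E.
move=> fS fT ST [r c] x /tposP Sx.
have xS : x \in symbols S by rewrite inE Sx.
have : x \in symbols T by rewrite fT -fS.
rewrite inE; case Tx: (tpos T x) => [[r' c']|//] _; apply/tposP; rewrite Tx.
have rr : r = r'.
  have := nth_row_word S x x; rewrite ST nth_row_word /row_of Sx Tx.
  by move=> /= ->.
have xk z : (z < x)%N -> (z < k)%N by move/ltn_trans; apply; rewrite -fS.
congr (Some (_, _)) => //; apply/val_inj => /=.
rewrite -(row_count_pos Tx) -(row_count_pos Sx) -rr -!count_row_word ?ST //.
  by move=> z /xk; rewrite fS.
by move=> z /xk; rewrite fT.
Qed.

Lemma tpos_fswap (F : filling n) (a b x : 'I_n) :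
  tpos (fswap a b F) x = tpos F (tperm a b x).
Proof.
apply: eq_pick => c; rewrite /= ffunE.
case: (F c) => //= y; apply/eqP/eqP => -[]; last by move=> ->; rewrite tpermK.
by move=> <-; rewrite tpermK.
Qed.

Lemma drop_enum_adj (a b : 'I_n) : b = a.+1 :> nat ->
  drop a (enum 'I_n) = [:: a, b & drop a.+2 (enum 'I_n)].
Proof.
move=> ab; rewrite (drop_nth a) ?size_enum_ord // nth_ord_enum; congr (_ :: _).
by rewrite -ab (drop_nth a) ?size_enum_ord // nth_ord_enum.
Qed.

Lemma drop_row_word (F : filling n) (a b : 'I_n) : b = a.+1 :> nat ->
  drop a (row_word F) = [:: row_of F a, row_of F b & drop a.+2 (row_word F)].
Proof.
by move=> ab; rewrite /row_word -map_drop (drop_enum_adj ab) /= map_drop.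
Qed.

Lemma row_word_fswap (F : filling n) (a b : 'I_n) : b = a.+1 :> nat ->
  a \in symbols F -> b \in symbols F ->
  row_word (fswap a b F) = swap_word a (row_word F).
Proof.
rewrite !inE => ab Fa Fb; rewrite /swap_word (drop_row_word _ ab).
have ro x : x != a -> x != b -> row_of (fswap a b F) x = row_of F x.
  by move=> xa xb; rewrite /row_of tpos_fswap tpermD // eq_sym.
have := enum_uniq 'I_n; rewrite -(cat_take_drop a (enum 'I_n)) (drop_enum_adj ab).
rewrite cat_uniq /= !inE !negb_or => /and5P[_ /and3P[at1 bt1 _] /andP[_ ad] bd _].
rewrite {1}/row_word -(cat_take_drop a (enum 'I_n)) (drop_enum_adj ab) map_cat /=.
rewrite /row_word -map_take -map_drop; congr (_ ++ [:: _, _ & _]).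
- apply/eq_in_map => x xt; apply: ro; apply/eqP => xE.
    by move: at1; rewrite -[X in X \in _]xE xt.
  by move: bt1; rewrite -[X in X \in _]xE xt.
- by rewrite /row_of tpos_fswap tpermL; case: (tpos F b) Fb.
- by rewrite /row_of tpos_fswap tpermR; case: (tpos F a) Fa.
- apply/eq_in_map => x xt; apply: ro; apply/eqP => xE.
    by move: ad; rewrite -[X in X \in _]xE xt.
  by move: bd; rewrite -[X in X \in _]xE xt.
Qed.

Lemma take_swap_word m j (w : seq 'I_n) : (j.+1 < m)%N ->
  take m (swap_word j w) = swap_word j (take m w).
Proof.
move=> jm; rewrite /swap_word.
have -> : drop j (take m w) = take (m - j) (drop j w).
  by rewrite take_drop subnK // ltnW // ltnW.
have [k kE] : exists k, (m - j = k.+2)%N.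
  by exists (m - j).-2; rewrite -subn2; lia.
rewrite kE; case E: (drop j w) => [|x [|y r]] //=.
have sj : size (take j w) = j.
  by apply/size_takel/ltnW; rewrite -subn_gt0 -size_drop E.
rewrite take_takel; last by lia.
by rewrite take_cat sj ifN ?kE //; lia.
Qed.

Lemma drop_swap_word m j (w : seq 'I_n) : (j.+1 < m)%N ->
  drop m (swap_word j w) = drop m w.
Proof.
move=> jm; rewrite /swap_word.
have [k kE] : exists k, (m = k.+2 + j)%N by exists (m - j.+2)%N; lia.
case E: (drop j w) => [|x [|y r]] //=.
have sj : size (take j w) = j.
  by apply/size_takel/ltnW; rewrite -subn_gt0 -size_drop E.
rewrite drop_cat sj ifN; last by lia.
by rewrite kE addnK -drop_drop E.
Qed.

Lemma drop_take_row_word m (F : filling n) (a b : 'I_n) : b = a.+1 :> nat ->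
  (b < m)%N -> exists r, drop a (take m (row_word F)) = [:: row_of F a, row_of F b & r].
Proof.
move=> ab bm.
have -> : drop a (take m (row_word F)) = take (m - a) (drop a (row_word F)).
  by rewrite take_drop subnK //; lia.
have [k ->] : exists k, (m - a = k.+2)%N.
  by exists (m - a).-2; lia.
by rewrite (drop_row_word _ ab) /=; eexists.
Qed.

Lemma filled_fswap k L Q (a b : 'I_n) : filled k L -> b = a.+1 :> nat ->
  (b < k)%N -> tab Q = fswap a b L -> filled k Q.
Proof.
move=> fL ab bk QE x; rewrite inE QE tpos_fswap -[LHS]/(_ != None).
have := fL (tperm a b x); rewrite inE => ->.
by case: tpermP => [->|->|] //; lia.
Qed.

(** The condition on rows is separate: swapping two equal letters returns a Yamanouchi word, but the
    swapped filling is not standard. *)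
Lemma nstandard_fswap k m L (a b : 'I_n) : filled k L -> (k <= n)%N ->
  b = a.+1 :> nat -> (b < m)%N -> (m <= k)%N ->
  nstandard lam (fswap a b L) =
  (row_of L a != row_of L b)
  && (swap_word a (take m (row_word L)) \in yamanouchi n m).
Proof.
move=> fL kn ab bm mk.
have aL : a \in symbols L by rewrite fL; lia.
have bL : b \in symbols L by rewrite fL; lia.
have amn : (a.+1 < m)%N by rewrite -ab.
move: (aL) (bL); rewrite !inE /row_of.
case La: (tpos L a) => [[r c]|//] _; case Lb: (tpos L b) => [[r' c']|//] _ /=.
move/tposP: (La) => La'; move/tposP: (Lb) => Lb'.
apply/idP/andP => [sQ|[rr Hw]].
  pose Q := Tableau sQ; have fQ : filled k Q by apply: (filled_fswap fL ab) => //; lia.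
  split.
    apply/eqP => rE; case: (ltngtP c c') => cc.
    - have Qa : tab Q (r', c') = Some a by rewrite ffunE Lb' /= tpermR.
      have Qb : tab Q (r, c) = Some b by rewrite ffunE La' /= tpermL.
      by have := tab_row Qb Qa rE cc; lia.
    - by have := tab_row Lb' La' (esym rE) cc; lia.
    - have ba : (r, c) = (r', c') by congr (_, _) => //; apply/val_inj.
      by move: La'; rewrite ba Lb' => -[ba']; move: ab; rewrite ba'; lia.
  rewrite -take_swap_word // -(row_word_fswap ab aL bL).
  by apply: (row_word_yamanouchi fQ).
(* Exchanging consecutive symbols reverses no comparison except that of a with b. *)
have order x y : (x < y)%N -> (x == a) && (y == b) = false ->
    (tperm a b x < tperm a b y)%N.
  have tv z : tperm a b z =
      (if z == a :> nat then b else if z == b :> nat then a else z)%N :> nat.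
    case: tpermP => [->|->|za zb]; first by rewrite eqxx.
      by rewrite eqxx; case: eqP.
    by rewrite !ifN //; apply/eqP => zE; [apply: zb|apply: za]; apply/val_inj.
  by rewrite !tv -!val_eqE /=; repeat case: eqP => //=; lia.
apply/and4P; split.
- apply/forallP => e; apply/eqP; rewrite ffunE -(tab_dom L).
  by case: (tab L e).
- apply/forallP => e; apply/forallP => e'; apply/implyP; rewrite !ffunE.
  case E: (tab L e) => [x|] //=; case E': (tab L e') => [y|] //= /eqP[] /perm_inj xy.
  by apply/eqP/(tab_inj E); rewrite xy.
- apply/forallP => e; apply/forallP => e'; apply/implyP; rewrite !ffunE.
  case E: (tab L e) => [x|] //=; case E': (tab L e') => [y|] //= /andP[/eqP e1 e2].
  rewrite /entry_lt; apply: order; first exact: tab_row E E' e1 e2.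
  apply/negP => /andP[/eqP xa /eqP yb]; rewrite xa yb in E E'.
  have := tab_inj E La'; have := tab_inj E' Lb' => ? ?; subst e e'.
  by move: rr; rewrite /= in e1; rewrite e1 eqxx.
- apply/forallP => e; apply/forallP => e'; apply/implyP; rewrite !ffunE.
  case E: (tab L e) => [x|] //=; case E': (tab L e') => [y|] //= /andP[/eqP e1 e2].
  rewrite /entry_lt; apply: order; first exact: tab_col E E' e1 e2.
  apply/negP => /andP[/eqP xa /eqP yb]; rewrite xa yb in E E'.
  have := tab_inj E La'; have := tab_inj E' Lb' => ? ?; subst e e'.
  rewrite /= in e1 e2; subst c'.
  (* With a and b in one column, rows r and r' both have c entries below a; after the swap the first
     b letters would make the lower row r' longer than r. *)
  have /yamanouchiP[_ /(_ b (ltnW bm)) /decreasing_partsP/(_ _ _ (ltnW e2))] := Hw.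
  rewrite !ffunE.
  have cr : row_count L a r = c by exact: row_count_pos La.
  have cr' : row_count L b r' = c by exact: row_count_pos Lb.
  have sa : size (take a (row_word L)) = a.
    by rewrite size_takel // size_row_word ltnW.
  have tE : take b (row_word L) = rcons (take a (row_word L)) r.
    rewrite -{1}(cat_take_drop a (row_word L)) (drop_row_word _ ab) ab take_cat sa.
    by rewrite ifN -?leqNgt // subSnn /= ?take0 cats1 /row_of La.
  rewrite -!count_row_word in cr cr'; last first.
  - by move=> z zb; rewrite fL; lia.
  - by move=> z zb; rewrite fL; lia.
  rewrite tE -cats1 count_cat /= (negbTE rr) /= !addn0 in cr'.
  have [s dE] := drop_take_row_word L ab bm.
  rewrite /swap_word dE take_cat.
  have -> : size (take a (take m (row_word L))) = a.
    by rewrite take_takel ?sa //; lia.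
  rewrite ifN; last by lia.
  rewrite ab subSnn /= ?take0 take_takel; last by lia.
  rewrite !count_cat /= {1 2}/row_of Lb /= eqxx eq_sym (negbTE rr) cr cr'; lia.
Qed.

End Tableaux.

(** * Action of the idempotents and of the permutations *)

Section RookElements.
Variable n : nat.
Implicit Types (A B : {set 'I_n}) (s t : rook n).

Lemma rookP s t : (forall i, rook_fun s i = rook_fun t i) -> s = t.
Proof. by move=> st; apply/val_inj/ffunP. Qed.

Lemma rook_perm_inj (s : 'S_n) : pinj [ffun i => Some (s i)].
Proof. by apply/pinjP => i j k; rewrite !ffunE => -[<-] [/perm_inj ->]. Qed.

Definition rook_perm (s : 'S_n) : rook n := Rook (rook_perm_inj s).

Lemma rook_perm1 : rook_perm 1 = rook_one n.
Proof. by apply: rookP => i; rewrite !ffunE perm1. Qed.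

Lemma rook_permM (s t : 'S_n) : rook_perm (s * t) = rook_mul (rook_perm t) (rook_perm s).
Proof. by apply: rookP => i; rewrite !ffunE /= ffunE permM. Qed.

Lemma rook_perm_tperm (a b : 'I_n) : rook_perm (tperm a b) = rook_tperm a b.
Proof. by apply: rookP => i; rewrite !ffunE. Qed.

Lemma rook_idem_inj A : pinj [ffun i => if i \in A then Some i else None].
Proof.
by apply/pinjP => i j k; rewrite !ffunE; do 2!case: ifP => // _; move=> -[->] [->].
Qed.

Definition rook_idem A : rook n := Rook (rook_idem_inj A).

Lemma rook_idemT : rook_idem setT = rook_one n.
Proof. by apply: rookP => i; rewrite !ffunE inE. Qed.

Lemma rook_idemI A B : rook_idem (A :&: B) = rook_mul (rook_idem A) (rook_idem B).
Proof.
by apply: rookP => i; rewrite !ffunE inE andbC; case: (i \in B) => //=; rewrite ffunE.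
Qed.

Lemma rook_mulA s t (u : rook n) : rook_mul s (rook_mul t u) = rook_mul (rook_mul s t) u.
Proof.
apply: rookP => i; rewrite !ffunE; case: (rook_fun u i) => //= x.
by rewrite !ffunE.
Qed.

End RookElements.

Section Representation.
Variables (C : fieldType) (n : nat) (lam : young n).
Variable rho : rook n -> 'M[C]_(tdim lam).
Hypothesis rhoH : halverson rho.
Implicit Types (L P Q : tableau lam) (A B : {set 'I_n}) (M : 'M[C]_(tdim lam)).

Lemma ll_rank_inj : injective (@ll_rank n lam).
Proof.
move=> P Q /(congr1 val) /= PQ.
have H L : L \in ll_enum lam by rewrite mem_sort mem_enum.
by rewrite -(nth_index P (H P)) PQ nth_index.
Qed.

Lemma ll_rankP (i : 'I_(tdim lam)) : exists L, i = ll_rank L.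
Proof.
have /inj_card_bij : injective (@ll_rank n lam) := ll_rank_inj.
by rewrite card_ord => /(_ (leqnn _))[g _ gK]; exists (g i).
Qed.

Definition tab_entry M P Q := M (ll_rank P) (ll_rank Q).

Lemma mul_vtabE M P Q : (M *m vtab C Q) (ll_rank P) 0 = tab_entry M P Q.
Proof. by rewrite -colE mxE. Qed.

Lemma vtabE P Q : vtab C Q (ll_rank P) 0 = (P == Q)%:R.
Proof. by rewrite mxE (inj_eq ll_rank_inj) andbT. Qed.

Lemma vfillP (F : filling n) :
  vfill C lam F = 0 \/ exists2 Q : tableau lam, tab Q = F & vfill C lam F = vtab C Q.
Proof.
rewrite /vfill; case: insubP => [Q _ QF|_]; [right; exists Q => //|by left].
Qed.

Lemma rho_swap2 (a b : 'I_n) : rho (rook_tperm a b) *m rho (rook_tperm a b) = 1%:M.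
Proof.
rewrite -(halversonM rhoH) -!rook_perm_tperm -rook_permM tperm2 rook_perm1.
exact: halverson1 rhoH.
Qed.

(** The swapped filling must be standard: otherwise v_L would be sent to 0 by a matrix whose square
    is the identity. *)
Lemma rho_swap_one (a b : 'I_n) L : b = a.+1 :> nat ->
  (a \in symbols L) (+) (b \in symbols L) ->
  exists2 Q : tableau lam, tab Q = fswap a b L &
    rho (rook_tperm a b) *m vtab C L = vtab C Q.
Proof.
move=> ab; rewrite !inE => one.
have E : rho (rook_tperm a b) *m vtab C L = vfill C lam (fswap a b L).
  rewrite (halverson_swap rhoH) // /swap_action; move: one.
  by case: (tpos L a); case: (tpos L b).
rewrite E; case: (vfillP (fswap a b L)) => // F0.
have : rho (rook_tperm a b) *m (rho (rook_tperm a b) *m vtab C L) = 0.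
  by rewrite E F0 mulmx0.
rewrite mulmxA rho_swap2 mul1mx => /(congr1 (fun v : 'cV_ _ => v (ll_rank L) 0)).
by rewrite vtabE mxE eqxx => /eqP; rewrite oner_eq0.
Qed.

Lemma symbols_fswap (F : filling n) (a b x : 'I_n) :
  (x \in symbols (fswap a b F)) = (tperm a b x \in symbols F).
Proof. by rewrite !inE tpos_fswap. Qed.

Lemma rook_idemC1 (a b : 'I_n) :
  rook_idem [set~ a] =
  rook_mul (rook_tperm a b) (rook_mul (rook_idem [set~ b]) (rook_tperm a b)).
Proof.
apply: rookP => i; rewrite !ffunE /= ffunE !inE.
have -> : (tperm a b i == b) = (i == a).
  by rewrite -{2}(tpermL a b) (inj_eq perm_inj).
by case: eqP => //= _; rewrite ffunE tpermK.
Qed.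

(** Descending induction on i, from the generator [n]: conjugation by (a, b) carries the idempotent
    omitting b to the one omitting a. *)
Lemma rho_idemC1 (i : 'I_n) L :
  rho (rook_idem [set~ i]) *m vtab C L = if i \in symbols L then 0 else vtab C L.
Proof.
have [m] := ubnP (n - i)%N; elim: m i L => // m IH a L am.
have [an|an] := eqVneq a.+1 n.
  have -> : rook_idem [set~ a] = rook_proj n.
    apply: rookP => i; rewrite !ffunE !inE -val_eqE /=.
    have -> : (i.+1 == n) = (i == a :> nat) by rewrite -[RHS]eqSS an.
    by case: eqP.
  rewrite (halverson_proj rhoH) /proj_action inE.
  case: existsP => [[x /andP[/eqP xn xL]]|H].
    have -> : a = x by apply/val_inj/eqP; rewrite /= -eqSS an xn.
    by rewrite xL.
  by case: ifP => // aL; case: H; exists a; rewrite an eqxx.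
have bn : (a.+1 < n)%N by rewrite ltn_neqAle an ltn_ord.
pose b := Ordinal bn; have ab : b = a.+1 :> nat by [].
have IHb Q : rho (rook_idem [set~ b]) *m vtab C Q
             = if b \in symbols Q then 0 else vtab C Q.
  by apply: IH; rewrite /=; lia.
rewrite (rook_idemC1 a b) !(halversonM rhoH) -!mulmxA.
have killF Q : b \in symbols (fswap a b Q) ->
    rho (rook_idem [set~ b]) *m vfill C lam (fswap a b Q) = 0.
  by case: (vfillP (fswap a b Q)) => [->|[S SF ->]]; rewrite ?mulmx0 // IHb SF => ->.
case aL: (a \in symbols L); case bL: (b \in symbols L).
- rewrite (halverson_swap rhoH) // /swap_action; move: (aL) (bL); rewrite !inE.
  case: (tpos L a) => // p _; case: (tpos L b) => // q _.
  rewrite mulmxDr -!scalemxAr IHb bL killF ?symbols_fswap ?tpermR //.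
  by rewrite !scaler0 addr0 mulmx0.
- have [|Q QF ->] := @rho_swap_one a b L ab; first by rewrite aL bL.
  by rewrite IHb QF symbols_fswap tpermR aL mulmx0.
- have [|Q QF QE] := @rho_swap_one a b L ab; first by rewrite aL bL.
  rewrite QE IHb QF symbols_fswap tpermR aL -QE mulmxA rho_swap2 mul1mx //.
- have E : rho (rook_tperm a b) *m vtab C L = vtab C L.
    rewrite (halverson_swap rhoH) // /swap_action; move: aL bL; rewrite !inE.
    by case: (tpos L a) => //; case: (tpos L b).
  by rewrite E IHb bL.
Qed.

Lemma rho_idem A L :
  rho (rook_idem A) *m vtab C L = if symbols L \subset A then vtab C L else 0.
Proof.
have [m] := ubnP #|~: A|; elim: m A => // m IH A Am.
have [AT|[i iA]] := set_0Vmem (~: A).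
  have -> : A = setT by rewrite -(setCK A) AT setC0.
  by rewrite rook_idemT (halverson1 rhoH) mul1mx subsetT.
have -> : A = (i |: A) :&: [set~ i].
  apply/setP => x; rewrite !inE; case: eqVneq => [->|] /=; last by rewrite andbT.
  by move: iA; rewrite inE => /negbTE.
rewrite rook_idemI (halversonM rhoH) -mulmxA rho_idemC1 subsetI.
have -> : (symbols L \subset [set~ i]) = (i \notin symbols L).
  by rewrite subsets_disjoint setCK disjoint_sym disjoints1.
case: (i \in symbols L); first by rewrite mulmx0 andbF.
rewrite andbT IH //; rewrite ltnS in Am; apply: leq_trans Am.
rewrite [in ltnRHS](cardsD1 i) iA add1n ltnS.
by apply/subset_leq_card/subsetP => x; rewrite !inE negb_or.
Qed.

(** The idempotent acts by a diagonal 0-1 matrix, so what [rho_idem] says of columns also holds for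
    rows. *)
Lemma rho_idem_row A P M : symbols P \subset A ->
  row (ll_rank P) (rho (rook_idem A) *m M) = row (ll_rank P) M.
Proof.
move=> PA; rewrite row_mul [RHS]rowE; congr (_ *m _); apply/rowP => j.
have [Q ->] := ll_rankP j; rewrite !mxE.
rewrite -[LHS]/(tab_entry _ _ _) -mul_vtabE rho_idem; case: ifP => QA.
  by rewrite vtabE (inj_eq ll_rank_inj) eqxx eq_sym.
rewrite mxE eqxx (inj_eq ll_rank_inj); case: eqP => // QP.
by rewrite QP PA in QA.
Qed.

End Representation.

(** * The seminormal transform on $S_k$ through row words *)

Section PermutationFourier.
Variables (C : fieldType) (n : nat) (lam : young n).
Variable rho : rook n -> 'M[C]_(tdim lam).
Hypothesis rhoH : halverson rho.
Implicit Types (L P Q : tableau lam) (M : 'M[C]_(tdim lam)).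
Implicit Types (X : seq 'I_n -> seq 'I_n -> C).

Lemma word_content_take L (x : 'I_n) (p : box n) : tpos L x = Some p ->
  (forall z : 'I_n, (z < x)%N -> z \in symbols L) ->
  word_content (take x (row_word L)) p.1 = content p.
Proof.
case: p => r c Lx Hz; rewrite /word_content /content /=.
by rewrite count_row_word // (row_count_pos Lx).
Qed.

Lemma adjE (a b : 'I_n) : b = a.+1 :> nat -> adj n a = tperm a b.
Proof. by move=> ab; rewrite /adj -ab !valK. Qed.

(* M preserves the positions of the symbols >= m, and its entries depend only   *)
(* on the rows of the symbols < m: this is the block structure of the           *)
(* restriction to S_m, and what lets X be computed once for all shapes.         *)
Definition word_matrix k m M X := forall P Q, filled k P -> filled k Q ->
  tab_entry M P Q =
  if drop m (row_word P) == drop m (row_word Q)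
  then X (take m (row_word P)) (take m (row_word Q)) else 0.

(** This is Halverson's formula for two present symbols: [word_content_take] reads contents off
    prefixes, and [nstandard_fswap] decides from the first m letters whether the second term
    survives. *)
Lemma word_matrix_adj k m j M X : (j.+1 < m)%N -> (m <= k)%N -> (k <= n)%N ->
  word_matrix k m M X ->
  word_matrix k m (M *m rho (rook_perm (adj n j))) (swap_op j X).
Proof.
move=> jm mk kn HM P Q fP fQ.
have bn : (j.+1 < n)%N by lia.
pose b := Ordinal bn; pose a := Ordinal (ltnW bn); have ab : b = a.+1 :> nat by [].
have bm : (b < m)%N by [].
have aQ : a \in symbols Q by rewrite fQ /=; lia.
have bQ : b \in symbols Q by rewrite fQ /=; lia.
rewrite -[j]/(a : nat) (adjE ab) rook_perm_tperm -mul_vtabE -mulmxA.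
rewrite (halverson_swap rhoH) // /swap_action.
have [r dE] := drop_take_row_word Q ab bm.
move: (aQ) (bQ); rewrite !inE.
case Qa: (tpos Q a) => [p|//] _; case Qb: (tpos Q b) => [q|//] _.
rewrite /swap_op dE take_takel; last by rewrite /=; lia.
have rb : row_of Q b = q.1 by rewrite /row_of Qb.
have ra : row_of Q a = p.1 by rewrite /row_of Qa.
have -> : rcons (take a (row_word Q)) (row_of Q a) = take b (row_word Q).
  by rewrite ab (take_nth a) ?size_row_word // nth_row_word.
have below (x z : 'I_n) : (x < k)%N -> (z < x)%N -> z \in symbols Q.
  by move=> xk zx; rewrite fQ; apply: ltn_trans xk.
rewrite ra rb (word_content_take Qa) ?(word_content_take Qb); last 2 first.
- by move=> z; apply: below; apply: leq_trans mk.
- by move=> z; apply: below; rewrite /=; lia.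
set c := (_^-1); rewrite mulmxDr -!scalemxAr mxE [X in X + _]mxE [X in _ + X]mxE.
rewrite mul_vtabE HM // -ra -rb size_takel ?size_row_word; last by lia.
rewrite -(nstandard_fswap fQ kn ab bm mk) /vfill.
case: insubP => [Q' sQ QE|/negbTE ->]; last first.
  by rewrite mulmx0 mxE mulr0 !addr0; case: ifP => //; rewrite mulr0.
have fQ' : filled k Q' by apply: (filled_fswap fQ ab _ QE); apply: leq_trans mk.
rewrite mul_vtabE HM // sQ QE (row_word_fswap ab aQ bQ).
rewrite drop_swap_word // take_swap_word //.
by case: ifP => // _; rewrite !mulr0 addr0.
Qed.

Lemma word_matrix_lift k m M X : (m < k)%N -> (k <= n)%N ->
  word_matrix k m M X -> word_matrix k m.+1 M (lift_op m X).
Proof.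
move=> mk kn HM P Q fP fQ; rewrite HM // /lift_op !take_takel //.
have dE (w : seq 'I_n) : drop m w = drop m (take m.+1 w) ++ drop m.+1 w.
  by rewrite -[LHS](cat_take_drop 1) take_drop drop_drop add1n.
rewrite (dE (row_word P)) (dE (row_word Q)) eqseq_cat; last first.
  by rewrite !size_drop !size_take !size_row_word.
by rewrite andbC; case: eqP; case: eqP.
Qed.

Lemma word_matrix_cycle k m i M X : (i <= m)%N -> (m < k)%N -> (k <= n)%N ->
  word_matrix k m.+1 M X ->
  word_matrix k m.+1 (M *m rho (rook_perm (cyc n m i))) (cycle_op m i X).
Proof.
move=> im mk kn HM; elim: i im => [|i IH] im /=.
  by rewrite rook_perm1 (halverson1 rhoH) mulmx1.
rewrite rook_permM (halversonM rhoH) mulmxA.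
by apply: word_matrix_adj (IH (ltnW im)) => //; lia.
Qed.

Definition fixes m (s : 'S_n) := [forall x : 'I_n, (m <= x)%N ==> (s x == x)].

Lemma fixesP m (s : 'S_n) :
  reflect (forall x : 'I_n, (m <= x)%N -> s x = x) (fixes m s).
Proof.
apply: (iffP forallP) => H x; last by apply/implyP => /H/eqP.
by move=> mx; apply/eqP/(implyP (H x)).
Qed.

Lemma cyc_fixes m i : (i <= m)%N -> fixes m.+1 (cyc n m i).
Proof.
move=> im; apply/fixesP => x mx; elim: i im => [|i IH] im /=; first by rewrite perm1.
rewrite permM; have -> : adj n (m - i.+1) x = x.
  rewrite /adj; case: (insubP 'I_n (m - i.+1)%N) => [a _ aE|_]; last by rewrite perm1.
  case: (insubP 'I_n (m - i.+1).+1) => [b _ bE|_]; last by rewrite perm1.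
  by rewrite tpermD //; apply/eqP => E; move: mx; rewrite -E /= ?aE ?bE; lia.
exact: IH (ltnW im).
Qed.

Lemma cyc_top m i (x y : 'I_n) : (i <= m)%N -> x = (m - i)%N :> nat -> y = m :> nat ->
  cyc n m i x = y.
Proof.
move=> im xE yE; elim: i x im xE => [|i IH] x im xE /=.
  by rewrite perm1; apply/val_inj; rewrite /= xE yE subn0.
have xn : (x.+1 < n)%N by have := ltn_ord y; lia.
by rewrite permM -xE (@adjE x (Ordinal xn)) // tpermL; apply: IH => /=; lia.
Qed.

(** The coset of s in $S_{m+1}$ is determined by the preimage m - i of m, which [cyc n m i] carries
    to m. *)
Lemma sum_fixes m (V : nmodType) (F : 'S_n -> V) : (m < n)%N ->
  \sum_(s | fixes m.+1 s) F s =
  \sum_(i < m.+1) \sum_(s | fixes m s) F (cyc n m i * s)%g.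
Proof.
move=> mn; pose y := Ordinal mn.
rewrite (partition_big (fun s : 'S_n => inord (m - (s^-1)%g y)%N : 'I_m.+1) xpredT) //=.
apply: eq_bigr => i _; rewrite (reindex_inj (mulgI (cyc n m i))).
have im : (i <= m)%N by rewrite -ltnS.
have xn : (m - i < n)%N by lia.
pose x := Ordinal xn; have cx : cyc n m i x = y by apply: cyc_top.
apply: eq_bigl => s; apply/andP/fixesP => [[/fixesP fs /eqP/(congr1 val) /=]|fs].
  rewrite inordK; last by rewrite ltnS leq_subr.
  set z := (_ y) => zi z' mz'.
  have zx : z = x.
    (* Truncated subtraction hides z > m; but then z would be a fixed point, while its image is
       m. *)
    apply/val_inj => /=; have [zm|zm] := leqP z m; first by move: zi; lia.
    have := fs z zm; rewrite /z permKV => zE.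
    by move: zm; rewrite {1}/z -zE /= ltnn.
  have sy : s y = y by rewrite -{1}cx -permM -zx /z permKV.
  move: mz'; rewrite leq_eqVlt => /predU1P[mE|mz'].
    by have -> : z' = y by apply/val_inj.
  rewrite -{2}(fs _ mz') permM; congr (s _).
  by apply/esym/(fixesP _ _ (cyc_fixes im)).
split.
  apply/fixesP => z mz; rewrite permM (fixesP _ _ (cyc_fixes im)) //.
  exact/fs/ltnW.
have -> : ((cyc n m i * s)^-1)%g y = x.
  by apply: (@perm_inj _ (cyc n m i * s)); rewrite permKV permM cx fs.
by apply/eqP/val_inj; rewrite /= inordK; rewrite /=; lia.
Qed.

(** At m = 0 the sum is a multiple of the identity, and [row_word_inj] turns equality of words into
    equality of tableaux; each further level splits by cosets. *)
Lemma word_matrix_fourier k m (g : 'S_n -> C) : (m <= k)%N -> (k <= n)%N ->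
  word_matrix k m (\sum_(s | fixes m s) g s *: rho (rook_perm s))
    (perm_fourier m g).
Proof.
move=> + kn; elim: m g => [|m IH] g mk /=.
  move=> P Q fP fQ; rewrite !drop0 (big_pred1 1%g) => [|s]; last first.
    apply/fixesP/eqP => [H|-> x _]; last by rewrite perm1.
    by apply/permP => x; rewrite H // perm1.
  rewrite /tab_entry mxE rook_perm1 (halverson1 rhoH) mxE (inj_eq (@ll_rank_inj _ _)).
  have [->|PQ] := eqVneq P Q; first by rewrite eqxx mulr1.
  by case: eqP => [/(row_word_inj fP fQ)/eqP|_]; rewrite ?(negbTE PQ) ?mulr0.
rewrite sum_fixes; last exact: leq_trans kn.
move=> P Q fP fQ; rewrite /tab_entry summxE.
transitivity (\sum_(i < m.+1) if drop m.+1 (row_word P) == drop m.+1 (row_word Q) then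
   cycle_op m i (lift_op m (perm_fourier m (fun s => g (cyc n m i * s)%g)))
     (take m.+1 (row_word P)) (take m.+1 (row_word Q)) else 0); last first.
  by case: ifP => // _; rewrite big1.
apply: eq_bigr => i _.
have im : (i <= m)%N by rewrite -ltnS.
have H := word_matrix_cycle im mk kn
  (word_matrix_lift mk kn (IH (fun s => g (cyc n m i * s)%g) (ltnW mk))).
rewrite -(H P Q fP fQ) /tab_entry; congr (fun_of_matrix _ _ _).
rewrite mulmx_suml; apply: eq_bigr => s _.
by rewrite rook_permM (halversonM rhoH) scalemxAl.
Qed.

End PermutationFourier.

(** * Decomposition into blocks *)

Section Blocks.
Variables (C : fieldType) (n : nat).
Implicit Types (A B : {set 'I_n}) (s t : rook n).

Lemma card_symbols (lam : young n) (L : tableau lam) :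
  #|symbols L| = #|[set b : box n | (b.2 < lam b.1)%N]|.
Proof.
pose e (b : box n) := odflt b.1 (tab L b).
have LS (b : box n) : (b.2 < lam b.1)%N -> tab L b = Some (e b).
  by rewrite -(tab_dom L) /e; case: (tab L b).
rewrite -[RHS](card_in_imset (f := e)); last first.
  move=> b b'; rewrite !inE => /LS Lb /LS Lb' bb.
  by apply: tab_inj Lb _; rewrite bb.
apply: eq_card => x; rewrite inE; apply/idP/imsetP => [|[b]].
  case Lx: (tpos L x) => [b|//] _; move/tposP: Lx => Lb; exists b.
    by rewrite inE -(tab_dom L) Lb.
  by rewrite /e Lb.
by rewrite inE => /LS /tposP Lb ->; rewrite Lb.
Qed.

Lemma down_closed_set A :
  (forall a b : 'I_n, b = a.+1 :> nat -> b \in A -> a \in A) ->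
  A = [set x : 'I_n | (x < #|A|)%N].
Proof.
move=> H; have down d : forall x y : 'I_n, x = (y + d)%N :> nat -> x \in A -> y \in A.
  elim: d => [|d IH] x y xy xA.
    by rewrite (_ : y = x) //; apply/val_inj; rewrite /= xy addn0.
  have zn : (y + d < n)%N by have := ltn_ord x; lia.
  apply: (IH (Ordinal zn)) => //; apply: H xA => /=; lia.
apply/setP => x; rewrite inE; case xA: (x \in A); apply/esym.
  rewrite -(card_set_ltn (ltn_ord x)); apply/subset_leq_card/subsetP => y.
  by rewrite inE ltnS => yx; apply: (down (x - y)%N x) => //; rewrite subnKC.
apply/negbTE; rewrite -leqNgt -[leqRHS](card_set_ltn (ltnW (ltn_ord x))).
apply/subset_leq_card/subsetP => y yA; rewrite inE ltnNge; apply/negP => xy.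
by rewrite (down (y - x)%N y x) ?subnKC // in xA.
Qed.

(* The same w serves all shapes, so that the blocks of all the representations  *)
(* at (A, B) are transforms of a single function on S_k.                        *)
Definition standardizes (w : 'S_n) A :=
  w @: A = [set x : 'I_n | (x < #|A|)%N] /\
  forall (lam : young n) (rho : rook n -> 'M[C]_(tdim lam)) (L : tableau lam),
    halverson rho -> symbols L = A ->
    exists2 Q : tableau lam, filled #|A| Q &
      rho (rook_perm w) *m vtab C L = vtab C Q.

(** While some b in A has its predecessor a outside A, apply (a, b): the sum of the elements drops
    by one, and [rho_swap_one] keeps basis vectors basis vectors. *)
Lemma standardizes_exists A : exists w, standardizes w A.
Proof.
have [m] := ubnP (\sum_(x in A) x)%N; elim: m A => // m IH A Am.
have [[a b] /= /and3P[/eqP ab bA aA]|H] :=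
  pickP (fun ab : 'I_n * 'I_n => [&& ab.2 == ab.1.+1 :> nat, ab.2 \in A & ab.1 \notin A]).
  pose A' := tperm a b @: A.
  have cA : #|A'| = #|A| by rewrite card_imset //; exact: perm_inj.
  have AE x : (x \in A') = (tperm a b x \in A).
    by rewrite -{1}[x](tpermK a b) mem_imset //; exact: perm_inj.
  have A'm : (\sum_(x in A') x < m)%N.
    rewrite big_imset /=; last by move=> x y _ _; exact: perm_inj.
    rewrite ltnS in Am; apply: leq_trans Am.
    rewrite (bigD1 b bA) [ltnRHS](bigD1 b bA) /= tpermR ab -addSn leq_add2l.
    apply: eq_leq; apply: eq_bigr => x /andP[xA xb]; rewrite tpermD // eq_sym //.
    by apply: contraNneq aA => <-.
  have [w [wA wL]] := IH A' A'm; exists (tperm a b * w)%g; split.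
    rewrite -cA -wA /A' -imset_comp; apply: eq_imset => x /=.
    by rewrite permM.
  move=> lam rho L rhoH LA.
  have [|Q QF QE] := @rho_swap_one _ _ _ _ rhoH a b L ab.
    by rewrite LA bA (negbTE aA).
  have [|Q' fQ' Q'E] := wL lam rho Q rhoH.
    by apply/setP => x; rewrite QF symbols_fswap AE LA.
  exists Q'; first by rewrite -cA.
  by rewrite rook_permM (halversonM rhoH) rook_perm_tperm -mulmxA QE.
have AE : A = [set x : 'I_n | (x < #|A|)%N].
  apply: down_closed_set => a b ab bA; apply/negP => /negP aA.
  by have := H (a, b); rewrite /= ab eqxx bA aA.
exists 1%g; split.
  by rewrite -AE; apply/setP => x; rewrite -{1}[x](perm1 x) mem_imset //; exact: perm_inj.
move=> lam rho L rhoH LA; exists L.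
  by move=> x; rewrite LA {1}AE inE.
by rewrite rook_perm1 (halverson1 rhoH) mul1mx.
Qed.

(** Row Q of [rho (rook_perm w)] must be the unit row at L. The idempotent of w(A) does not affect
    this row; moved past w it kills every v_S with S not filled by A. *)
Lemma standardizes_row w A (lam : young n) (rho : rook n -> 'M[C]_(tdim lam))
    (L Q : tableau lam) (M : 'M[C]_(tdim lam)) :
  halverson rho -> standardizes w A -> symbols L = A -> filled #|A| Q ->
  rho (rook_perm w) *m vtab C L = vtab C Q ->
  row (ll_rank Q) (rho (rook_perm w) *m M) = row (ll_rank L) M.
Proof.
move=> rhoH [wA wL] LA fQ QE; rewrite row_mul [RHS]rowE; congr (_ *m _).
have winj (u v : 'cV[C]_(tdim lam)) :
    rho (rook_perm w) *m u = rho (rook_perm w) *m v -> u = v.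
  move=> /(congr1 (mulmx (rho (rook_perm w^-1)))).
  by rewrite !mulmxA -(halversonM rhoH) -rook_permM mulgV rook_perm1
    (halverson1 rhoH) !mul1mx.
rewrite -(@rho_idem_row _ _ _ _ rhoH (w @: A)); last first.
  by apply/subsetP => x; rewrite fQ wA inE.
rewrite -(halversonM rhoH).
have -> : rook_mul (rook_idem (w @: A)) (rook_perm w)
          = rook_mul (rook_perm w) (rook_idem A).
  apply: rookP => i; rewrite !ffunE /= ffunE mem_imset; last exact: perm_inj.
  by case: (i \in A) => //=; rewrite ffunE.
apply/rowP => j; have [S ->] := ll_rankP j; rewrite !mxE eqxx.
rewrite (inj_eq (@ll_rank_inj _ _)) /=.
rewrite -[LHS]/(tab_entry _ _ _) -mul_vtabE (halversonM rhoH) -mulmxA (rho_idem rhoH).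
case: ifP => [SA|SA]; last first.
  rewrite mulmx0 mxE; case: eqP => // SL.
  by rewrite SL LA subxx in SA.
have SE : symbols S = A.
  by apply/eqP; rewrite eqEcard SA -LA !card_symbols leqnn.
have [Q' _ Q'E] := wL _ _ S rhoH SE; rewrite Q'E vtabE.
congr (_%:R); congr nat_of_bool; apply/eqP/eqP => [QQ|SL].
  have : vtab C S = vtab C L by apply: winj; rewrite Q'E QE QQ.
  move=> /(congr1 (fun v : 'cV_ _ => v (ll_rank S) 0)); rewrite !vtabE eqxx.
  by case: eqP => // _ /eqP; rewrite oner_eq0.
have : vtab C Q = vtab C Q' by rewrite -QE -Q'E SL.
move=> /(congr1 (fun v : 'cV_ _ => v (ll_rank Q) 0)); rewrite !vtabE eqxx.
by case: eqP => // _ /eqP; rewrite oner_eq0.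
Qed.

Definition rook_dom t : {set 'I_n} := [set i | rook_fun t i != None].
Definition rook_im t : {set 'I_n} := [set j | [exists i, rook_fun t i == Some j]].

(** For p in $S_k$, this is the bijection A -> B that becomes p after relabelling A and B by 1, ...,
    k. *)
Definition block_rook A (wA wB p : 'S_n) : rook n :=
  rook_mul (rook_perm wB^-1)
    (rook_mul (rook_perm p) (rook_mul (rook_perm wA) (rook_idem A))).

Lemma block_rookE A (wA wB p : 'S_n) i :
  rook_fun (block_rook A wA wB p) i =
  if i \in A then Some ((wB^-1)%g (p (wA i))) else None.
Proof. by rewrite !ffunE; case: (i \in A); rewrite //= !ffunE /= !ffunE /= !ffunE. Qed.

Lemma dom_block_rook A (wA wB p : 'S_n) : rook_dom (block_rook A wA wB p) = A.
Proof. by apply/setP => i; rewrite inE block_rookE; case: (i \in A). Qed.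

Section Pair.
Variables (A B : {set 'I_n}) (wA wB : 'S_n).
Hypotheses (AB : #|A| = #|B|) (HA : standardizes wA A) (HB : standardizes wB B).

Let wAE x : (wA x < #|A|)%N = (x \in A).
Proof.
by have /setP/(_ (wA x)) := HA.1; rewrite inE mem_imset //; exact: perm_inj.
Qed.

Let wBE x : (wB x < #|A|)%N = (x \in B).
Proof.
by have /setP/(_ (wB x)) := HB.1; rewrite AB inE mem_imset //; exact: perm_inj.
Qed.

Let fixes_lt (p : 'S_n) x : fixes #|A| p -> (p x < #|A|)%N = (x < #|A|)%N.
Proof.
move/fixesP => fp; case: (ltnP x #|A|) => xA; last first.
  by rewrite fp // ltnNge xA.
rewrite ltnNge; apply/negP => pA; have := fp _ pA => /perm_inj E.
by move: pA; rewrite E leqNgt xA.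
Qed.

Lemma block_rook_inj : {in fixes #|A| &, injective (block_rook A wA wB)}.
Proof.
move=> p q fp fq pq; apply/permP => x; case: (ltnP x #|A|) => xA; last first.
  by rewrite (fixesP _ _ fp) // (fixesP _ _ fq).
have [i xE] : exists i, x = wA i by exists ((wA^-1)%g x); rewrite permKV.
move: xA; rewrite xE wAE => iA.
by have := congr1 (fun t => rook_fun t i) pq; rewrite /= !block_rookE iA => -[/perm_inj].
Qed.

Lemma im_block_rook p : fixes #|A| p -> rook_im (block_rook A wA wB p) = B.
Proof.
move=> fp; apply/setP => j; rewrite inE; apply/existsP/idP => [[x]|jB].
  rewrite block_rookE; case: ifP => // xA /eqP[<-].
  by rewrite -wBE permKV fixes_lt // wAE.
exists ((wA^-1)%g ((p^-1)%g (wB j))).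
by rewrite block_rookE -wAE permKV -(fixes_lt _ fp) permKV wBE jB permK.
Qed.

Lemma block_rook_surj s :
  (forall i, i \in A -> exists2 j, j \in B & rook_fun s i = Some j) ->
  exists2 p, fixes #|A| p & rook_mul s (rook_idem A) = block_rook A wA wB p.
Proof.
move=> sAB.
(* The relabelled restriction of s to A, extended by the identity; the inner default branch is never
   reached. *)
pose h (x : 'I_n) := if (x < #|A|)%N then
  (if rook_fun s ((wA^-1)%g x) is Some j then wB j else x) else x.
have hlt (x : 'I_n) : (x < #|A|)%N ->
    exists2 j, rook_fun s ((wA^-1)%g x) = Some j & (h x = wB j) /\ (h x < #|A|)%N.
  move=> xA; have [|j jB sj] := sAB ((wA^-1)%g x); first by rewrite -wAE permKV.
  by exists j => //; rewrite /h xA sj wBE.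
have hge (x : 'I_n) : (x < #|A|)%N = false -> h x = x by rewrite /h => ->.
have hinj : injective h.
  move=> x y; case xA: (x < #|A|)%N; case yA: (y < #|A|)%N.
  - have [j sj [-> _]] := hlt _ xA; have [j' sj' [-> _]] := hlt _ yA.
    move=> /perm_inj jj; rewrite -jj in sj'.
    exact: perm_inj (pinjP _ (rook_inj s) _ _ _ sj sj').
  - have [j _ [_ hx]] := hlt _ xA; rewrite (hge _ yA) => xy.
    by rewrite xy yA in hx.
  - have [j _ [_ hy]] := hlt _ yA; rewrite (hge _ xA) => xy.
    by rewrite -xy xA in hy.
  - by rewrite !hge.
exists (perm hinj).
  by apply/fixesP => x; rewrite leqNgt permE => /negbTE/hge.
apply: rookP => i; rewrite block_rookE !ffunE; case iA: (i \in A) => //=.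
have [j jB sj] := sAB i iA; rewrite sj; congr Some.
have -> : perm hinj (wA i) = wB j by rewrite permE /h wAE iA permK sj.
by rewrite permK.
Qed.

Lemma card_fixes k : (k <= n)%N -> #|fixes (n := n) k| = k`!.
Proof.
move=> kn; rewrite -{2}(card_set_ltn kn) -card_perm; apply: eq_card => p.
apply/fixesP/subsetP => H x.
  by rewrite !inE; apply: contraNltn => /H ->.
move=> kx; apply/eqP; apply: contraLR kx => px; rewrite -ltnNge.
by have := H x; rewrite !inE => ->.
Qed.

Lemma card_block :
  (#|A|`! <= #|[set t : rook n | (rook_dom t == A) && (rook_im t == B)]|)%N.
Proof.
rewrite -card_fixes; last by rewrite -[leqRHS](card_ord n) max_card.
rewrite -(card_in_imset block_rook_inj); apply/subset_leq_card/subsetP => t.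
by case/imsetP => p fp ->; rewrite inE dom_block_rook im_block_rook // !eqxx.
Qed.

Lemma drop_row_word_filled k (lam : young n) (P Q : tableau lam) :
  filled k P -> filled k Q -> drop k (row_word P) = drop k (row_word Q).
Proof.
move=> fP fQ; have sz (S : tableau lam) : size (drop k (row_word S)) = (n - k)%N.
  by rewrite size_drop size_row_word.
case: (posnP n) => [n0|n0].
  by rewrite !drop_oversize ?size_row_word // n0.
apply: (@eq_from_nth _ (Ordinal n0)); rewrite !sz // => i ik; rewrite !nth_drop.
have kin : (k + i < n)%N by lia.
rewrite !(nth_row_word _ _ (Ordinal kin)) /row_of.
have := fP (Ordinal kin); have := fQ (Ordinal kin); rewrite !inE /=.
by rewrite ltnNge leq_addr /=; case: (tpos Q _) => //; case: (tpos P _).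
Qed.

(** A zeta transform for the restriction order: the condition says that s extends t. *)
Definition upper_sum (f : rook n -> C) t : C :=
  \sum_(s | rook_mul s (rook_idem (rook_dom t)) == t) f s.

(** The entry depends on s only through its restriction to A and vanishes unless s maps A into B, so
    the s can be grouped by restriction. The pair of words does not depend on f. *)
Lemma fourier_block (lam : young n) (rho : rook n -> 'M[C]_(tdim lam))
    (L' L : tableau lam) : halverson rho -> symbols L' = B -> symbols L = A ->
  exists2 pq, pq \in yam_pairs n #|A| & forall f : rook n -> C,
    \sum_s f s * tab_entry (rho s) L' L =
    perm_fourier #|A| (fun p => upper_sum f (block_rook A wA wB p)) pq.1 pq.2.
Proof.
move=> rhoH L'B LA; set k := #|A|.
have kn : (k <= n)%N by rewrite -[leqRHS](card_ord n) max_card.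
have [P + PE] := HB.2 _ _ L' rhoH L'B; rewrite -AB => fP.
have [Q fQ QE] := HA.2 _ _ L rhoH LA.
exists (take k (row_word P), take k (row_word Q)).
  rewrite mem_yam_pairs !(row_word_yamanouchi (k := k)) //=.
  by rewrite (row_word_content fP fQ).
move=> f /=.
have := word_matrix_fourier rhoH
  (fun p => upper_sum f (block_rook A wA wB p)) (leqnn k) kn fP fQ.
rewrite (drop_row_word_filled fP fQ) eqxx => <-.
pose T s := tab_entry (rho s) L' L.
have TA s : T (rook_mul s (rook_idem A)) = T s.
  by rewrite /T -!mul_vtabE (halversonM rhoH) -mulmxA (rho_idem rhoH) LA subxx.
have TB s : T (rook_mul (rook_idem B) s) = T s.
  have := @rho_idem_row _ _ _ _ rhoH B L' (rho s); rewrite L'B subxx => /(_ isT).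
  by move/rowP/(_ (ll_rank L)); rewrite !mxE /T /tab_entry (halversonM rhoH) mxE.
(* Row L' becomes row P through wB, and column L becomes column Q through wA. *)
have Tblock p : tab_entry (rho (rook_perm p)) P Q = T (block_rook A wA wB p).
  have fP' : filled #|B| P by rewrite -AB.
  have := standardizes_row (rho (block_rook A wA wB p)) rhoH HB L'B fP' PE.
  move/rowP/(_ (ll_rank L)); rewrite mxE [RHS]mxE -/(tab_entry _ _ _) -/(T _) => <-.
  rewrite -(halversonM rhoH) /block_rook !rook_mulA -rook_permM mulVg rook_perm1.
  have -> : rook_mul (rook_one n) (rook_perm p) = rook_perm p.
    by apply: rookP => i; rewrite !ffunE /= ffunE.
  rewrite -[RHS]/(tab_entry _ _ _) -!mul_vtabE !(halversonM rhoH) -!mulmxA (rho_idem rhoH).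
  by rewrite LA subxx QE.
(* If the part of s from A to B is undefined somewhere on A, the idempotent of its domain kills
   v_L. *)
have Tsupp s : T s != 0 ->
    forall i, i \in A -> exists2 j, j \in B & rook_fun s i = Some j.
  move=> Ts i iA; pose t := rook_mul (rook_idem B) (rook_mul s (rook_idem A)).
  have Tt : T t != 0 by rewrite TB TA.
  have tD : t = rook_mul t (rook_idem (rook_dom t)).
    apply: rookP => x; rewrite [RHS]ffunE [X in obind _ X]ffunE inE.
    by case: eqP => //= ->.
  have : i \in rook_dom t.
    suff /subsetP : A \subset rook_dom t by apply.
    apply: contraNT Tt => /negbTE AD; rewrite /T {1}tD -mul_vtabE (halversonM rhoH).
    by rewrite -mulmxA (rho_idem rhoH) LA AD mulmx0 mxE.
  rewrite inE !ffunE iA /=; case: (rook_fun s i) => //= j.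
  by rewrite ffunE; case: ifP => // jB _; exists j.
rewrite /tab_entry summxE.
transitivity (\sum_(p | fixes k p)
    \sum_(s | rook_mul s (rook_idem A) == block_rook A wA wB p) f s * T s).
  rewrite (exchange_big_dep xpredT) //=; apply: eq_bigr => s _.
  have [T0|/Tsupp/block_rook_surj[p fp sp]] := eqVneq (T s) 0.
    by rewrite -/(tab_entry _ _ _) -/(T s) T0 mulr0 big1.
  rewrite (big_pred1 p) // => q; rewrite sp; apply/andP/eqP => [[fq /eqP E]|->].
    by apply/esym/block_rook_inj.
  by rewrite eqxx.
apply: eq_bigr => p _; rewrite mxE -/(tab_entry _ _ _) Tblock /upper_sum big_distrl /=.
rewrite dom_block_rook; apply: eq_bigr => s /eqP <-.
by rewrite TA.
Qed.

End Pair.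

(** For fixed s, each t restricts s and is determined by its domain, which leaves at most $2^n$
    choices. *)
Lemma card_upper_sums :
  (\sum_(t : rook n) #|[pred s | rook_mul s (rook_idem (rook_dom t)) == t]|
   <= 2 ^ n * #|{: rook n}|)%N.
Proof.
under eq_bigr do rewrite -sum1_card.
rewrite (exchange_big_dep xpredT) //= mulnC -sum_nat_const; apply: leq_sum => s _.
have -> : (2 ^ n = #|powerset [set: 'I_n]|)%N by rewrite card_powerset cardsT card_ord.
rewrite sum1_card.
have inj : {in [pred t | rook_mul s (rook_idem (rook_dom t)) == t] &, injective rook_dom}.
  by move=> t t'; rewrite !inE => /eqP + /eqP + tt'; rewrite tt' => -> ->.
rewrite -(card_in_imset inj); apply/subset_leq_card/subsetP => A _.
by rewrite inE subsetT.
Qed.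

Lemma card_blocks :
  (\sum_(AB : {set 'I_n} * {set 'I_n} | #|AB.1| == #|AB.2|) #|AB.1|`!
   <= #|{: rook n}|)%N.
Proof.
rewrite -sum1_card (partition_big (fun t => (rook_dom t, rook_im t)) xpredT) //=.
rewrite [leqRHS](bigID (fun AB : {set 'I_n} * {set 'I_n} => #|AB.1| == #|AB.2|)) /=.
rewrite -[leqLHS]addn0.
apply: leq_add => //; apply: leq_sum => -[A B] /= /eqP AB.
have [wA HA] := standardizes_exists A; have [wB HB] := standardizes_exists B.
apply: leq_trans (card_block AB HA HB) _; rewrite -sum1_card.
by apply: eq_leq; apply: eq_bigl => t; rewrite inE.
Qed.

End Blocks.

(** * Total operation count and the program *)

(** At n = 5 this reads 127 <= 160; at n = 4 it would be 66 against 64. The induction step reduces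
    to $2n + 1 \le 2^n$. *)
Lemma sum_step_costs n : (5 <= n)%N ->
  (2 ^ n + \sum_(i < n) i.+1 * (2 * i + 1) <= 2 ^ n * n)%N.
Proof.
elim: n => // n IH; rewrite leq_eqVlt => /predU1P[<-|].
  by rewrite !big_ord_recr big_ord0.
rewrite ltnS => n5; have {}IH := IH n5.
have : (2 * n + 1 <= 2 ^ n)%N.
  clear IH; elim: n n5 => // n IH; rewrite leq_eqVlt => /predU1P[<-|] //.
  by rewrite ltnS expnS => n5; have := IH n5; lia.
rewrite big_ord_recr expnS /=; move: IH; set S := (\sum_(_ < _) _)%N; nia.
Qed.

Lemma perm_cost_le_card n (A : {set 'I_n}) :
  (perm_cost n #|A| <= #|A|`! * \sum_(i < n) i.+1 * (2 * i + 1))%N.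
Proof.
apply: leq_trans (perm_cost_le n #|A|) _; rewrite leq_mul2l; apply/orP; right.
have kn : (#|A| <= n)%N by rewrite -[leqRHS](card_ord n) max_card.
rewrite -!(big_mkord xpredT (fun i => i.+1 * (2 * i + 1))%N).
by rewrite [leqRHS](big_cat_nat (n := #|A|)) //= leq_addr.
Qed.

Section Program.
Variables (C : fieldType) (n : nat).
Variable Y : forall lam : young n, rook n -> 'M[C]_(tdim lam).
Hypothesis YH : forall lam, halverson (Y lam).

Lemma extends_upper_sums (P : program (rook n) C) :
  extends P (2 ^ n * #|{: rook n}|) (fun h => exists t, h = (fun f => upper_sum f t)).
Proof.
pose pre (t : rook n) := [pred s | rook_mul s (rook_idem (rook_dom t)) == t].
apply: extends_sub (extends_family (l := index_enum {: rook n})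
  (m := fun t : rook n => size (enum (pre t)))
  (B := fun t : rook n => eq (fun f => 0 + \sum_(s <- enum (pre t)) 1 * f s)) _).
- under eq_bigr do rewrite -cardE; exact: card_upper_sums.
- move=> _ [t ->]; eexists; first by exists t; first exact: mem_index_enum.
  move=> f; rewrite add0r big_enum /=.
  by apply: eq_bigr => s _; rewrite mul1r.
move=> t Q _; refine (@extends_lincomb (rook n) C (rook n) (enum (pre t)) _ (fun=> 1)
  (fun s f => f s) (fun=> 0) (avail_const _ 0) _) => s _.
exact: avail_input.
Qed.

(** Tableaux of one shape have equally many symbols, so the pairs (A, B) of equal size cover all
    entries; each pair is processed once for all shapes. *)
Lemma extends_fourier_blocks (P : program (rook n) C) :
  (forall t, avail P (fun f => upper_sum f t)) ->
  extends P (#|{: rook n}| * \sum_(i < n) i.+1 * (2 * i + 1))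
    (fun h => exists (lam : young n) (L' L : tableau lam),
       h = (fun f => \sum_s f s * tab_entry (Y lam s) L' L)).
Proof.
move=> HP.
pose pairs (AB : {set 'I_n} * {set 'I_n}) := #|AB.1| == #|AB.2|.
pose l := filter pairs (index_enum _).
apply: extends_sub (extends_family (l := l)
  (m := fun AB : {set 'I_n} * {set 'I_n} => perm_cost n #|AB.1|)
  (B := fun (AB : {set 'I_n} * {set 'I_n}) h =>
    exists (lam : young n) (L' L : tableau lam), [/\ symbols L = AB.1, symbols L' = AB.2 &
        h = (fun f => \sum_s f s * tab_entry (Y lam s) L' L)]) _).
- rewrite big_filter; apply: (@leq_trans (\sum_(AB : {set 'I_n} * {set 'I_n}
      | #|AB.1| == #|AB.2|) #|AB.1|`! * \sum_(i < n) i.+1 * (2 * i + 1))).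
    by apply: leq_sum => AB _; exact: perm_cost_le_card.
  by rewrite -big_distrl leq_mul2r (card_blocks C n) orbT.
- move=> _ [lam [L' [L ->]]]; eexists; last by move=> f.
  exists (symbols L, symbols L'); last by exists lam, L', L.
  by rewrite mem_filter mem_index_enum /pairs /= !card_symbols eqxx.
move=> [A B] Q; rewrite mem_filter => /andP[/eqP /= AB _].
have [wA HA] := standardizes_exists C A; have [wB HB] := standardizes_exists C B.
apply: extends_sub (extends_perm_fourier #|A|
  (G := fun p f => upper_sum f (block_rook A wA wB p)) _) => // [h|p].
  move=> [lam [L' [L [LA L'B ->]]]].
  have [pq Hpq E] := fourier_block AB HA HB (YH lam) L'B LA.
  by eexists; [exists pq|move=> f; rewrite E].
by apply: avail_cat; exact: HP.
Qed.

Lemma fourier_program : (5 <= n)%N ->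
  exists2 p, computes_fourier Y p & (size p <= 2 ^ n * n * #|{: rook n}|)%N.
Proof.
move=> n5.
have [q sq Hq] : extends [::] (2 ^ n * #|{: rook n}| +
    #|{: rook n}| * \sum_(i < n) i.+1 * (2 * i + 1))
    (fun h => exists (lam : young n) (L' L : tableau lam),
       h = (fun f => \sum_s f s * tab_entry (Y lam s) L' L)).
  apply: extends_trans (extends_upper_sums [::]) _ => Q HQ.
  by apply: extends_fourier_blocks => t; apply: HQ; exists t.
exists q => [lam i j|].
  have [L' ->] := ll_rankP i; have [L ->] := ll_rankP j.
  have [o Ho] := Hq _ (ex_intro _ lam (ex_intro _ L' (ex_intro _ L erefl))).
  exists o => f; rewrite Ho /fourier summxE.
  by apply: eq_bigr => s _; rewrite mxE.
apply: leq_trans sq _; rewrite mulnC -mulnDr mulnC leq_mul2r.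
by rewrite sum_step_costs ?orbT.
Qed.

(** A least size exists by well-ordering; the property quantifies over all f, so it is made boolean
    classically. *)
Lemma fourier_complexity_exists N :
  (exists2 p, computes_fourier Y p & (size p <= N)%N) ->
  exists T, fourier_complexity Y T /\ (T <= N)%N.
Proof.
case=> p Hp pN.
have ex : exists m, `[< exists2 q, computes_fourier Y q & size q = m >].
  by exists (size p); apply/asboolP; exists p.
case: (ex_minnP ex) => T /asboolP HT Tmin; exists T; split.
  by split=> // q Hq; apply: Tmin; apply/asboolP; exists q.
by apply: leq_trans pN; apply: Tmin; apply/asboolP; exists p.
Qed.
End Program.

Theorem theorem10p3 (R : realType) (n : nat) (hn : (5 <= n)%N)
    (Y : forall lam : young n, rook n -> 'M[R[i]%C]_(#|{: tableau lam}|))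
    (hY : forall lam : young n, halverson (Y lam)) :
  exists T : nat,
    fourier_complexity Y T /\ (T <= 2 ^ n * n * #|{: rook n}|)%N.
Proof. exact/fourier_complexity_exists/fourier_program. Qed.
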